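(* Let $\rho_1,\rho_2,b,k,k_0,l,\delta$ be positive real constants, and assume that $l\neq p\pi$ for all $p\in\mathbb{Z}$. Let $\mathcal{H}$ be the Hilbert space and $\mathcal{A}:D(\mathcal{A})\subset\mathcal{H}\to\mathcal{H}$ the linear operator associated with the Bresse system, as defined in the context. Then the $C_0$ semigroup $(e^{t\mathcal{A}})_{t\ge0}$ on $\mathcal{H}$ associated with the Cauchy problem $\Phi_t=\mathcal{A}\Phi$, $\Phi(0)=\Phi_0$, is not exponentially stable.
   Context: All function spaces consist of complex-valued functions. Let $L^2_*(0,1)=\{v\in L^2(0,1):\int_0^1 v\,dx=0\}$ and $H^1_*(0,1)=H^1(0,1)\cap L^2_*(0,1)$. Set $$\mathcal{H}=H^1_0(0,1)\times L^2(0,1)\times H^1_*(0,1)\times L^2_*(0,1)\times H^1_*(0,1)\times L^2_*(0,1),$$ with elements written $\Phi=(\varphi,\tilde\varphi,\psi,\tilde\psi,w,\tilde w)^T$, equipped with the inner product $$\langle\Phi_1,\Phi_2\rangle_{\mathcal{H}}=k\langle\varphi_{1x}+\psi_1+lw_1,\varphi_{2x}+\psi_2+lw_2\rangle+k_0\langle w_{1x}-l\varphi_1,w_{2x}-l\varphi_2\rangle+b\langle\psi_{1x},\psi_{2x}\rangle+\rho_1\langle\tilde\varphi_1,\tilde\varphi_2\rangle+\rho_2\langle\tilde\psi_1,\tilde\psi_2\rangle+\rho_1\langle\tilde w_1,\tilde w_2\rangle,$$ where $\langle\cdot,\cdot\rangle$ on the right is the $L^2(0,1)$ inner product and the subscript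 $x$ denotes the derivative in $x$. When $l\ne p\pi$ for all $p\in\mathbb{Z}$, $\mathcal{H}$ is a Hilbert space for this inner product. The operator $\mathcal{A}$ is $$\mathcal{A}\Phi=\begin{pmatrix}\tilde\varphi\\ \frac{k}{\rho_1}(\varphi_x+\psi+lw)_x+\frac{lk_0}{\rho_1}(w_x-l\varphi)-\frac{\delta}{\rho_1}\tilde\varphi\\ \tilde\psi\\ \frac{b}{\rho_2}\psi_{xx}-\frac{k}{\rho_2}(\varphi_x+\psi+lw)\\ \tilde w\\ \frac{k_0}{\rho_1}(w_x-l\varphi)_x-\frac{lk}{\rho_1}(\varphi_x+\psi+lw)\end{pmatrix}$$ with domain $D(\mathcal{A})$ the set of $\Phi\in\mathcal{H}$ such that $\varphi\in H^2(0,1)\cap H^1_0(0,1)$; $\psi,w\in H^2(0,1)\cap H^1_*(0,1)$; $\tilde\varphi\in H^1_0(0,1)$; $\tilde\psi,\tilde w\in H^1_*(0,1)$; and $\psi_x(0)=w_x(0)=\psi_x(1)=w_x(1)=0$. The problem $\Phi_t=\mathcal{A}\Phi$ is the first-order form (with $\tilde\varphi=\varphi_t$, $\tilde\psi=\psi_t$, $\tilde w=w_t$) of the Bresse system on $(0,1)\times(0,\infty)$ $$\rho_1\varphi_{tt}-k(\varphi_x+\psi+lw)_x-lk_0(w_x-l\varphi)+\delta\varphi_t=0,\quad \rho_2\psi_{tt}-b\psi_{xx}+k(\varphi_x+\psi+lw)=0,\quad \rho_1w_{tt}-k_0(w_x-l\varphi)_x+lk(\varphi_x+\psi+lw)=0$$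 with boundary conditions $\varphi=\psi_x=w_x=0$ at $x=0$ and $x=1$. When $l\ne p\pi$ for all $p\in\mathbb{Z}$, $\mathcal{A}$ generates a $C_0$ semigroup of contractions $(e^{t\mathcal{A}})_{t\ge0}$ on $\mathcal{H}$. A $C_0$ semigroup $(e^{t\mathcal{A}})_{t\ge 0}$ is exponentially stable if there exist constants $C,\omega>0$ such that $\|e^{t\mathcal{A}}\|_{\mathcal{L}(\mathcal{H})}\le Ce^{-\omega t}$ for all $t\ge0$. *)

(* Defs.v *)
From HB Require Import structures.
From mathcomp Require Import all_boot all_order all_algebra ring_quotient.
From mathcomp Require Import complex ring lra.
From mathcomp Require Import all_classical all_reals all_analysis measurable_realfun.

Set Implicit Arguments.
Unset Strict Implicit.
Unset Printing Implicit Defensive.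

Import Order.TTheory GRing.Theory Num.Theory numFieldNormedType.Exports.

Local Open Scope classical_set_scope.
Local Open Scope complex_scope.
Local Open Scope ring_scope.
Local Open Scope quotient_scope.

Section FunctionSpaces.
Variable R : realType.
Local Notation mu := (@lebesgue_measure R).
Local Notation I01 := [set` `]0 : R, 1 : R[ ].
Local Notation re := (@complex.Re R).
Local Notation im := (@complex.Im R).
Implicit Types f g : R -> R[i].

(* Functions live on the whole line; only their restriction to ]0, 1[ matters. *)
Definition sqint : {pred R -> R[i]} := [pred f |
  `[< [/\ measurable_fun I01 (re \o f), measurable_fun I01 (im \o f) &
       mu.-integrable I01 (fun x => (re (f x) ^+ 2 + im (f x) ^+ 2)%:E)] >]].

Definition cint f : R[i] :=
  (\int[mu]_(x in I01) re (f x)) +i* (\int[mu]_(x in I01) im (f x)).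

Lemma reD (x y : R[i]) : re (x + y) = re x + re y.
Proof. by case: x; case: y. Qed.
Lemma imD (x y : R[i]) : im (x + y) = im x + im y.
Proof. by case: x; case: y. Qed.
Lemma reM (x y : R[i]) : re (x * y) = re x * re y - im x * im y.
Proof. by case: x; case: y. Qed.
Lemma imM (x y : R[i]) : im (x * y) = re x * im y + im x * re y.
Proof. by case: x => a b; case: y. Qed.

Lemma sqint_submod_closed : submod_closed sqint.
Proof.
split.
  apply/asboolP; split; try exact: measurable_cst.
  rewrite (_ : (fun x => _) = cst 0%E); first exact: integrable0.
  by apply/funext => x /=; rewrite /GRing.zero /= expr2 mulr0 addr0.
move=> a f g /asboolP[fr fi ff] /asboolP[gr gi gg]; apply/asboolP.
have mr : measurable_fun I01 (re \o (a *: f + g)).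
  rewrite (_ : _ \o _ = fun x => re a * re (f x) - im a * im (f x) + re (g x)).
    apply: measurable_funD => //; apply: measurable_funB;
      by apply: measurable_funM => //; exact: measurable_cst.
  by apply/funext => x /=; rewrite reD reM.
have mi : measurable_fun I01 (im \o (a *: f + g)).
  rewrite (_ : _ \o _ = fun x => re a * im (f x) + im a * re (f x) + im (g x)).
    apply: measurable_funD => //; apply: measurable_funD;
      by apply: measurable_funM => //; exact: measurable_cst.
  by apply/funext => x /=; rewrite imD (imM a).
split => //.
pose c := re a ^+ 2 + im a ^+ 2.
apply: (@le_integrable _ _ _ mu I01 _ _
  (fun x => ((2 * c)%:E * (re (f x) ^+ 2 + im (f x) ^+ 2)%:E
          + 2%:E * (re (g x) ^+ 2 + im (g x) ^+ 2)%:E)%E)) => //.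
- by apply/measurable_EFinP; apply: measurable_funD; exact: measurable_funX.
- move=> x _; rewrite -!EFinM -EFinD !abse_EFin lee_fin.
  rewrite ger0_norm ?addr_ge0 ?sqr_ge0 // ger0_norm; last first.
    by rewrite addr_ge0 ?mulr_ge0 ?addr_ge0 ?sqr_ge0.
  rewrite reD imD reM imM /c.
  move: (re a) (im a) (re (f x)) (im (f x)) (re (g x)) (im (g x)).
  move=> p q r s t u.
  rewrite -subr_ge0.
  rewrite (_ : _ - _ = (p * r - q * s - t) ^+ 2 + (p * s + q * r - u) ^+ 2).
    by rewrite addr_ge0 ?sqr_ge0.
  by rewrite !expr2; ring.
- by apply: integrableD => //; apply: integrableZl.
Qed.

HB.instance Definition _ :=
  GRing.isSubmodClosed.Build _ _ sqint sqint_submod_closed.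

Record L2fun := MkL2fun { L2fun_val :> R -> R[i]; _ : L2fun_val \in sqint }.

HB.instance Definition _ := [isSub for L2fun_val].
HB.instance Definition _ := [Choice of L2fun by <:].
HB.instance Definition _ := [SubChoice_isSubLmodule of L2fun by <:].

Definition ae0 : {pred L2fun} :=
  [pred f : L2fun | `[< (f : R -> R[i]) = cst 0 %[ae mu in I01] >]].

#[local] Instance ae_mu_filter : Filter (nbhs (almost_everywhere mu)).
Proof. exact: ae_filter_ringOfSetsType. Qed.

Lemma ae0_submod_closed : submod_closed ae0.
Proof.
split; first by apply/asboolP; apply: aeW.
move=> a f g /asboolP f0 /asboolP g0; apply/asboolP.
apply: filterS2 f0 g0 => x fx gx Ix.
by rewrite /= -[LHS]/(a *: (f x) + g x) fx // gx // /cst scaler0 addr0.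
Qed.

HB.instance Definition _ :=
  GRing.isSubmodClosed.Build _ _ ae0 ae0_submod_closed.

(* L^2(0,1): square-integrable complex functions modulo a.e. equality. *)
Definition L2 : Type := Quotient.quot ae0.

HB.instance Definition _ := Choice.on L2.
HB.instance Definition _ := EqQuotient.on L2.
HB.instance Definition _ := GRing.Zmodule.on L2.

Definition L2_repr (u : L2) : R -> R[i] := L2fun_val (repr u).
Coercion L2_repr : L2 >-> Funclass.

Lemma L2_eqP (f g : L2fun) :
  reflect ((f : R -> R[i]) = g %[ae mu in I01]) (\pi_L2 f == \pi_L2 g).
Proof.
rewrite -Quotient.idealrBE; apply: (iffP (asboolP _)); apply: filterS => x h Ix.
  by apply/eqP; rewrite -subr_eq0; apply/eqP; exact: h.
by rewrite /= -[LHS]/(f x - g x) h // subrr.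
Qed.

Lemma L2_pi_ae (f : L2fun) : L2_repr (\pi_L2 f) = f %[ae mu in I01].
Proof. by apply/L2_eqP; rewrite reprK. Qed.

Definition L2_scale (a : R[i]) (u : L2) : L2 := \pi_L2 (a *: repr u).

Lemma L2_piD (f g : L2fun) : \pi_L2 (f + g) = \pi_L2 f + \pi_L2 g.
Proof. by rewrite [LHS]Quotient.pi_add. Qed.

Lemma L2_pi_scale a (f : L2fun) : L2_scale a (\pi_L2 f) = \pi_L2 (a *: f).
Proof.
apply/eqP/L2_eqP; apply: filterS (L2_pi_ae f) => x h Ix.
by rewrite -[LHS]/(a *: L2_repr (\pi_L2 f) x) h.
Qed.

Fact L2_scalerA a b u : L2_scale a (L2_scale b u) = L2_scale (a * b) u.
Proof.
elim/quotW: u => f.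
by rewrite (L2_pi_scale b f) (L2_pi_scale a) (L2_pi_scale _ f) scalerA.
Qed.
Fact L2_scale1r : left_id 1 L2_scale.
Proof. by elim/quotW=> f; rewrite (L2_pi_scale 1 f) scale1r. Qed.
Fact L2_scalerDr : right_distributive L2_scale +%R.
Proof.
move=> a; elim/quotW=> f; elim/quotW=> g.
by rewrite -L2_piD !(L2_pi_scale a) scalerDr L2_piD.
Qed.
Fact L2_scalerDl u : {morph L2_scale^~ u : a b / a + b}.
Proof.
by elim/quotW: u => f a b; rewrite /= !(L2_pi_scale _ f) scalerDl L2_piD.
Qed.

HB.instance Definition _ := GRing.Zmodule_isLmodule.Build R[i] L2
  L2_scalerA L2_scale1r L2_scalerDr L2_scalerDl.

Lemma L2_linE a (u v : L2) :
  (a *: u + v : L2) = (fun x => a * u x + v x) %[ae mu in I01].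
Proof.
have -> : a *: u + v = \pi_L2 (a *: repr u + repr v) :> L2.
  by rewrite L2_piD; congr (_ + _); rewrite reprK.
exact: L2_pi_ae.
Qed.

Lemma L2_0E : (0 : L2) = (fun=> 0) %[ae mu in I01].
Proof.
rewrite (_ : 0 = \pi_L2 0); first exact: L2_pi_ae.
by rewrite -[0]/(Quotient.zero _) /Quotient.zero; unlock.
Qed.

Lemma L2_sqint (u : L2) : (u : R -> R[i]) \in sqint.
Proof. by rewrite /L2_repr; case: (repr u). Qed.

Lemma integrable_re_im f g : f \in sqint -> g \in sqint ->
  mu.-integrable I01 (fun x => (re (f x * g x))%:E) /\
  mu.-integrable I01 (fun x => (im (f x * g x))%:E).
Proof.
move=> /asboolP[fr fi ff] /asboolP[gr gi gg].
have fg : mu.-integrable I01 (fun x => (re (f x) ^+ 2 + im (f x) ^+ 2)%:E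
    + (re (g x) ^+ 2 + im (g x) ^+ 2)%:E)%E by exact: integrableD.
split; apply: le_integrable fg => //.
- apply/measurable_EFinP.
  rewrite (_ : (fun x => _) = (re \o f) \* (re \o g) \- (im \o f) \* (im \o g)).
    by apply: measurable_funB; apply: measurable_funM.
  by apply/funext => x; rewrite reM.
- move=> x _; rewrite /= lee_fin reM.
  move: (re (f x)) (im (f x)) (re (g x)) (im (g x)) => r s t u.
  rewrite [leRHS]ger0_norm ?addr_ge0 ?sqr_ge0 //.
  have := (sqr_ge0 r, sqr_ge0 s, sqr_ge0 t, sqr_ge0 u).
  have := (sqr_ge0 (r + t), sqr_ge0 (s - u), sqr_ge0 (r - t), sqr_ge0 (s + u)).
  rewrite !expr2 => -[[[? ?] ?] ?] [[[? ?] ?] ?].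
  by rewrite ler_norml; apply/andP; split; lra.
- apply/measurable_EFinP.
  rewrite (_ : (fun x => _) = (re \o f) \* (im \o g) \+ (im \o f) \* (re \o g)).
    by apply: measurable_funD; apply: measurable_funM.
  by apply/funext => x; rewrite imM.
- move=> x _; rewrite /= lee_fin imM.
  move: (re (f x)) (im (f x)) (re (g x)) (im (g x)) => r s t u.
  rewrite [leRHS]ger0_norm ?addr_ge0 ?sqr_ge0 //.
  have := (sqr_ge0 r, sqr_ge0 s, sqr_ge0 t, sqr_ge0 u).
  have := (sqr_ge0 (r + u), sqr_ge0 (s + t), sqr_ge0 (r - u), sqr_ge0 (s - t)).
  rewrite !expr2 => -[[[? ?] ?] ?] [[[? ?] ?] ?].
  by rewrite ler_norml; apply/andP; split; lra.
Qed.

Lemma L2_mul_integrable (u : L2) g : g \in sqint ->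
  mu.-integrable I01 (EFin \o fun x => re (u x * g x)) /\
  mu.-integrable I01 (EFin \o fun x => im (u x * g x)).
Proof. exact/integrable_re_im/L2_sqint. Qed.

Lemma ae_eq_Rintegral (h k : R -> R) :
  mu.-integrable I01 (EFin \o h) -> mu.-integrable I01 (EFin \o k) ->
  h = k %[ae mu in I01] -> \int[mu]_(x in I01) h x = \int[mu]_(x in I01) k x.
Proof.
move=> /integrableP[mh _] /integrableP[mk _] hk.
rewrite /Rintegral; congr fine; apply: ae_eq_integral => //.
by apply: filterS hk => x + Ix => /(_ Ix) ->.
Qed.

Lemma cint_linear a (u v : L2) g : g \in sqint ->
  cint (fun x => (a *: u + v : L2) x * g x) =
  a * cint (fun x => u x * g x) + cint (fun x => v x * g x).
Proof.
move=> gs.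
have [ur ui] := L2_mul_integrable u gs.
have [vr vi] := L2_mul_integrable v gs.
have [wr wi] := L2_mul_integrable (a *: u + v) gs.
have uvE : (fun x => (a *: u + v : L2) x * g x) =
    (fun x => a * (u x * g x) + v x * g x) %[ae mu in I01].
  by apply: filterS (L2_linE a u v) => x + Ix => /(_ Ix) ->; rewrite mulrDl mulrA.
have mI : measurable (I01 : set (measurableTypeR R)) by exact: measurable_itv.
have Zi (c : R) (h : R -> R) : mu.-integrable I01 (EFin \o h) ->
    mu.-integrable I01 (EFin \o (fun x => c * h x)).
  by move=> hi; have := integrableZl mI c hi; exact.
have Di (h k : R -> R) : mu.-integrable I01 (EFin \o h) ->
    mu.-integrable I01 (EFin \o k) ->
    mu.-integrable I01 (EFin \o (fun x => h x + k x)).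
  by move=> hi ki; have := integrableD mI hi ki; exact.
apply/eqP; rewrite eq_complex; apply/andP; split; apply/eqP.
- rewrite reD reM /=.
  transitivity (\int[mu]_(x in I01)
      (re a * re (u x * g x) + (- im a) * im (u x * g x) + re (v x * g x))).
    apply: ae_eq_Rintegral => //.
      by apply: (Di) => //; apply: (Di); exact: Zi.
    by apply: filterS uvE => x + Ix => /(_ Ix) ->; rewrite reD (reM a) mulNr.
  rewrite RintegralD //; last by apply: (Di); exact: Zi.
  by rewrite RintegralD ?RintegralZl // ?mulNr //; exact: Zi.
- rewrite imD imM /=.
  transitivity (\int[mu]_(x in I01)
      (re a * im (u x * g x) + im a * re (u x * g x) + im (v x * g x))).
    apply: ae_eq_Rintegral => //.
      by apply: (Di) => //; apply: (Di); exact: Zi.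
    by apply: filterS uvE => x + Ix => /(_ Ix) ->; rewrite imD (imM a).
  rewrite RintegralD //; last by apply: (Di); exact: Zi.
  by rewrite RintegralD ?RintegralZl //; exact: Zi.
Qed.

Lemma continuous_sqint (p : R -> R) : continuous p ->
  (fun x => (p x)%:C) \in sqint.
Proof.
move=> pc; apply/asboolP; split => /=.
- apply: measurable_funTS; exact: continuous_measurable_fun.
- exact: measurable_cst.
- rewrite (_ : (fun x => _) = EFin \o (fun x => p x ^+ 2)); last first.
    by apply/funext => x /=; rewrite [in LHS]expr2 [_ + _ * _]/= mulr0 addr0.
  apply: (@integrableS _ _ _ mu `[0, 1]) => //.
    by apply: subset_itv_oo_cc.
  apply: continuous_compact_integrable; first exact: segment_compact.
  apply: continuous_subspaceT => x.
  by under eq_fun do rewrite expr2; apply: continuousM; exact: pc.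
Qed.

Lemma cint_linear1 a (u v : L2) :
  cint (a *: u + v : L2) = a * cint u + cint v.
Proof.
have E (w : L2) : cint w = cint (fun x => w x * (1 : R)%:C).
  by congr cint; apply/funext => x; rewrite mulr1.
rewrite !E; apply: cint_linear.
by apply: continuous_sqint; exact: cst_continuous.
Qed.

(* C^1 functions with compact support in ]0, 1[. Real-valued ones suffice to
   test complex-valued functions, and C^1 ones give the same weak derivatives
   as smooth ones. *)
Definition test_fun (p : R -> R) : Prop :=
  [/\ forall x, derivable p x 1, continuous (derive1 p) &
      exists a b : R, [/\ 0 < a, b < 1 & forall x, p x != 0 -> a <= x <= b]].

Definition is_wderiv (u v : L2) : Prop := forall p, test_fun p ->
  cint (fun x => u x * (derive1 p x)%:C) = - cint (fun x => v x * (p x)%:C).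

(* The weak derivative, unique when it exists; junk value 0 otherwise. *)
Definition wderiv (u : L2) : L2 := xget 0 [set v | is_wderiv u v].

Definition H1 : {pred L2} := [pred u | `[< exists v, is_wderiv u v >]].

Lemma test_fun_sqint p : test_fun p ->
  (fun x => (p x)%:C) \in sqint /\ (fun x => (derive1 p x)%:C) \in sqint.
Proof.
case=> dp cp _; split; apply: continuous_sqint => // x.
exact/differentiable_continuous/derivable1_diffP.
Qed.

Lemma is_wderiv_linear a u v u' v' :
  is_wderiv u u' -> is_wderiv v v' -> is_wderiv (a *: u + v) (a *: u' + v').
Proof.
move=> hu hv p tp; have [ps p's] := test_fun_sqint tp.
by rewrite !cint_linear // hu // hv // mulrN opprD.
Qed.

Lemma is_wderiv0 : is_wderiv 0 0.
Proof.
have E : (0 : L2) = -1 *: 0 + 0 by rewrite scaler0 addr0.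
have C0 g : g \in sqint -> cint (fun x => (0 : L2) x * g x) = 0.
  by move=> gs; rewrite {1}E cint_linear // mulN1r addNr.
by move=> p tp; have [ps p's] := test_fun_sqint tp; rewrite !C0 // oppr0.
Qed.

Lemma H1_submod_closed : submod_closed H1.
Proof.
split; first by apply/asboolP; exists 0; exact: is_wderiv0.
move=> a u v /asboolP[u' hu] /asboolP[v' hv]; apply/asboolP.
by exists (a *: u' + v'); exact: is_wderiv_linear.
Qed.

HB.instance Definition _ :=
  GRing.isSubmodClosed.Build _ _ H1 H1_submod_closed.

Definition H2 : {pred L2} := [pred u | (u \in H1) && (wderiv u \in H1)].

(* [bdval u x c]: the representative of u continuous on [0, 1] takes the value
   c at x. *)
Definition bdval (u : L2) (x : R) (c : R[i]) : Prop :=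
  exists f : R -> R[i]^o, [/\ {within [set` `[0 : R, 1 : R]], continuous f},
    (u : R -> R[i]) = f %[ae mu in I01] & f x = c].

(* The functions in H^1 with zero trace at both endpoints. *)
Definition H10_pred : {pred L2} :=
  [pred u | (u \in H1) && `[< bdval u 0 0 /\ bdval u 1 0 >]].

Lemma bdval_linear x a u v c d :
  bdval u x c -> bdval v x d -> bdval (a *: u + v) x (a * c + d).
Proof.
move=> [f [fc fE fx]] [g [gc gE gx]].
exists (fun y => a *: f y + g y); split.
- move=> y; apply: (@cvgD _ R[i]^o); last exact: gc.
  by apply: (@cvgZl_tmp _ R[i]^o); exact: fc.
- apply: filterS3 (L2_linE a u v) fE gE => y + + + Iy.
  by move=> /(_ Iy) -> /(_ Iy) -> /(_ Iy) ->.
- by rewrite fx gx.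
Qed.

Lemma bdval0 x : bdval 0 x 0.
Proof.
exists (fun=> 0); split => //; last exact: L2_0E.
by move=> y; exact: cst_continuous.
Qed.

Lemma H10_submod_closed : submod_closed H10_pred.
Proof.
split.
  by apply/andP; split; [exact: rpred0|apply/asboolP; split; exact: bdval0].
move=> a u v /andP[u1 /asboolP[u0 uE]] /andP[v1 /asboolP[v0 vE]].
apply/andP; split; first by rewrite rpredD // rpredZ.
have E : 0 = a * 0 + 0 :> R[i] by rewrite mulr0 addr0.
by apply/asboolP; split; rewrite [X in bdval _ _ X]E; exact: bdval_linear.
Qed.

HB.instance Definition _ :=
  GRing.isSubmodClosed.Build _ _ H10_pred H10_submod_closed.

Definition L2s_pred : {pred L2} := [pred u : L2 | cint u == 0].

Lemma L2s_submod_closed : submod_closed L2s_pred.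
Proof.
have C0 : cint (0 : L2) = 0.
  have E : (0 : L2) = -1 *: 0 + 0 by rewrite scaler0 addr0.
  by rewrite {1}E cint_linear1 mulN1r addNr.
split; first exact/eqP.
move=> a u v /eqP u0 /eqP v0; apply/eqP.
by rewrite cint_linear1 u0 v0 mulr0 addr0.
Qed.

HB.instance Definition _ :=
  GRing.isSubmodClosed.Build _ _ L2s_pred L2s_submod_closed.

Definition H1s_pred : {pred L2} := [predI H1 & L2s_pred].

Lemma H1s_submod_closed : submod_closed H1s_pred.
Proof.
split; first by apply/andP; split; exact: rpred0.
move=> a u v /andP[u1 u0] /andP[v1 v0].
by apply/andP; split; rewrite rpredD // rpredZ.
Qed.

HB.instance Definition _ :=
  GRing.isSubmodClosed.Build _ _ H1s_pred H1s_submod_closed.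

(* H10, L2s and H1s are H^1_0(0,1), L^2_*(0,1) and H^1_*(0,1). *)
Record H10 := MkH10 { H10_val :> L2; _ : H10_val \in H10_pred }.
HB.instance Definition _ := [isSub for H10_val].
HB.instance Definition _ := [Choice of H10 by <:].
HB.instance Definition _ := [SubChoice_isSubLmodule of H10 by <:].

Record L2s := MkL2s { L2s_val :> L2; _ : L2s_val \in L2s_pred }.
HB.instance Definition _ := [isSub for L2s_val].
HB.instance Definition _ := [Choice of L2s by <:].
HB.instance Definition _ := [SubChoice_isSubLmodule of L2s by <:].

Record H1s := MkH1s { H1s_val :> L2; _ : H1s_val \in H1s_pred }.
HB.instance Definition _ := [isSub for H1s_val].
HB.instance Definition _ := [Choice of H1s by <:].
HB.instance Definition _ := [SubChoice_isSubLmodule of H1s by <:].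

Definition L2_dot (u v : L2) : R[i] := cint (fun x => u x * (v x)^*).

End FunctionSpaces.

Section C0Semigroup.
Variables (R : realType) (E : lmodType R[i]) (nrm : E -> R).

Definition op_norm (f : E -> E) : \bar R :=
  ereal_sup [set (nrm (f x))%:E | x in [set x | nrm x <= 1]].

Record is_C0_semigroup (T : R -> E -> E) : Prop := {
  C0_linear : forall t, 0 <= t -> linear (T t);
  C0_bounded : forall t, 0 <= t -> (op_norm (T t) < +oo)%E;
  C0_zero : forall x, T 0 x = x;
  C0_add : forall s t x, 0 <= s -> 0 <= t -> T (s + t) x = T s (T t x);
  C0_cont : forall x, nrm (T t x - x) @[t --> 0^'+] --> (0 : R) }.

(* An operator is given by its graph: [A x y] means x \in D(A) and A x = y. *)
Definition generates (A : E -> E -> Prop) (T : R -> E -> E) : Prop :=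
  forall x y, A x y <->
    nrm ((t^-1)%:C *: (T t x - x) - y) @[t --> 0^'+] --> (0 : R).

Definition exp_stable (T : R -> E -> E) : Prop :=
  exists C omega : R, [/\ 0 < C, 0 < omega &
    forall t, 0 <= t -> (op_norm (T t) <= (C * expR (- (omega * t)))%:E)%E].

End C0Semigroup.

Section Bresse.
Variable R : realType.
Variables rho1 rho2 b k k0 l delta : R.
Local Notation D := (@wderiv R).

Definition bresse_space : Type :=
  (H10 R * L2 R * H1s R * L2s R * H1s R * L2s R)%type.
HB.instance Definition _ := GRing.Lmodule.on bresse_space.

(* phi_x + psi + l w and w_x - l phi *)
Definition shear (Phi : bresse_space) : L2 R :=
  let: (phi, phit, psi, psit, w, wt) := Phi in
  D phi + (psi : L2 R) + l%:C *: (w : L2 R).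

Definition axial (Phi : bresse_space) : L2 R :=
  let: (phi, phit, psi, psit, w, wt) := Phi in
  D w - l%:C *: (phi : L2 R).

Definition bresse_dot (Phi1 Phi2 : bresse_space) : R[i] :=
  let: (phi1, phit1, psi1, psit1, w1, wt1) := Phi1 in
  let: (phi2, phit2, psi2, psit2, w2, wt2) := Phi2 in
  k%:C * L2_dot (shear Phi1) (shear Phi2)
  + k0%:C * L2_dot (axial Phi1) (axial Phi2)
  + b%:C * L2_dot (D psi1) (D psi2)
  + rho1%:C * L2_dot phit1 phit2
  + rho2%:C * L2_dot psit1 psit2
  + rho1%:C * L2_dot wt1 wt2.

Definition bresse_norm (Phi : bresse_space) : R :=
  Num.sqrt (complex.Re (bresse_dot Phi Phi)).

(* The memberships of phi, psi and w in H^1_0 and H^1_* are part of the type. *)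
Definition bresse_dom (Phi : bresse_space) : Prop :=
  let: (phi, phit, psi, psit, w, wt) := Phi in
  [/\ (phi : L2 R) \in @H2 R, (psi : L2 R) \in @H2 R & (w : L2 R) \in @H2 R] /\
  [/\ phit \in @H10_pred R, (psit : L2 R) \in @H1s_pred R
    & (wt : L2 R) \in @H1s_pred R] /\
  [/\ bdval (D psi) 0 0, bdval (D w) 0 0, bdval (D psi) 1 0 & bdval (D w) 1 0].

(* The graph of the Bresse operator: Phi \in D(A) and A Phi = Psi. *)
Definition bresse_op (Phi Psi : bresse_space) : Prop :=
  bresse_dom Phi /\
  let: (phi, phit, psi, psit, w, wt) := Phi in
  let: (f1, f2, f3, f4, f5, f6) := Psi in
  [/\ (f1 : L2 R) = phit,
      f2 = (k / rho1)%:C *: D (shear Phi) + (l * k0 / rho1)%:C *: axial Phi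
           - (delta / rho1)%:C *: phit
    & (f3 : L2 R) = psit] /\
  [/\ (f4 : L2 R) = (b / rho2)%:C *: D (D psi) - (k / rho2)%:C *: shear Phi,
      (f5 : L2 R) = wt
    & (f6 : L2 R) = (k0 / rho1)%:C *: D (axial Phi)
                    - (l * k / rho1)%:C *: shear Phi].

End Bresse.

(* Main.v *)
Require Import Defs.
From mathcomp Require Import all_boot all_order all_algebra complex.
From mathcomp Require Import all_classical all_reals all_analysis.
From mathcomp Require Import measurable_realfun ring lra.

Import Order.TTheory GRing.Theory Num.Theory numFieldNormedType.Exports.
Local Open Scope ring_scope.

(** Exponential stability would bound the resolvent of the generator along the
    imaginary axis; it is unbounded there, because the friction acts on [phi]
    alone and some rapid vibrations of [psi] and [w] barely move [phi].

    The two halves are [resolvent_bound], which turns exponential stability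
    into an estimate |x| <= K |i lam x - A x| for all real lam and all x in
    the domain of A, and [quasimodes], which exhibits vectors that violate
    every such estimate.

    For mu = (n + 1) pi the boundary conditions make the vectors with [phi]
    components multiples of sin (mu x) and [psi], [w] components multiples of
    cos (mu x) a six-dimensional subspace invariant under A. Inside it take
    phi = (alpha / mu) sin (mu x), psi = gamma cos (mu x),
    w = eta cos (mu x), with velocities i lam times the positions and
    lam = sigma mu. Then i lam Phi - A Phi has zero position components, and
    its velocity components are, up to terms bounded in mu, constant multiples
    of
      mu (alpha (k - rho1 sigma^2) + k gamma + l (k + k0) eta),
      mu^2 gamma (b - rho2 sigma^2),   mu^2 eta (k0 - rho1 sigma^2).
    If the three factors vanish, the residual stays bounded whereas
    the norm of Phi is at least of order sigma mu (|gamma| + |eta|). A solution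
    with (gamma, eta) <> 0 always exists ([quasimode_amplitudes]). When the
    speed of [psi], or else that of [w], differs from the speed of [phi], let
    that component vibrate alone at its own speed; alpha then absorbs the
    coupling. When all speeds agree, combine [psi] and [w] so that their
    actions on [phi] cancel: this is why equal speeds, which suffice for
    the Timoshenko beam, do not help here.

    The remaining work is calculus in L^2: the weak derivative has to be
    linear on H^1 and has to be computed on sines and cosines, and both
    require its uniqueness, hence the fundamental lemma of the calculus of
    variations. *)

(** * Exponential stability bounds the resolvent on the imaginary axis *)
Section ResolventBound.
Local Open Scope classical_set_scope.
Local Open Scope ring_scope.
Local Open Scope complex_scope.
Variables (R : realType) (E : lmodType R[i]) (nrm : E -> R).
Local Notation normc := ComplexField.Normc.normc.

Definition is_seminorm : Prop :=
  (forall a x, nrm (a *: x) = normc a * nrm x) /\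
  (forall x y, nrm (x + y) <= nrm x + nrm y).

Hypothesis nrmP : is_seminorm.

Let nrmZ a x : nrm (a *: x) = normc a * nrm x. Proof. exact: nrmP.1. Qed.
Let nrmD x y : nrm (x + y) <= nrm x + nrm y. Proof. exact: nrmP.2. Qed.

Let normcC (r : R) : normc r%:C = `|r|.
Proof. by rewrite /= expr0n /= addr0 sqrtr_sqr. Qed.

Let nrmN x : nrm (- x) = nrm x.
Proof.
rewrite -scaleN1r nrmZ (_ : -1 = (-1)%:C); last by rewrite rmorphN1.
by rewrite normcC normrN1 mul1r.
Qed.

Lemma seminorm_ge0 x : 0 <= nrm x.
Proof.
have : nrm (0 *: x) <= nrm x + nrm x.
  by rewrite scale0r -(subrr x) (le_trans (nrmD _ _))// nrmN.
by rewrite nrmZ ComplexField.Normc.normc0 mul0r; lra.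
Qed.

Let nrmZ_le a x : normc a <= 1 -> nrm (a *: x) <= nrm x.
Proof. by move=> a1; rewrite nrmZ ler_piMl ?seminorm_ge0. Qed.

(** Vectors of seminorm 0 cannot be normalised; for them the bound on the
    image comes from the unboundedness of the multiples of x, all of which lie
    in the unit ball. *)
Lemma le_op_norm (f : E -> E) (M : R) x : linear f ->
  (op_norm nrm f <= M%:E)%E -> nrm (f x) <= M * nrm x.
Proof.
move=> fl fM.
have fZ a u : f (a *: u) = a *: f u.
  have f0 : f 0 = 0.
    by have := fl (-1) 0 0; rewrite scaler0 addr0 scaleN1r addNr.
  by have := fl a u 0; rewrite addr0 f0 addr0.
have unitball u : nrm u <= 1 -> nrm (f u) <= M.
  move=> u1; rewrite -lee_fin; apply: le_trans fM.
  by apply: ereal_sup_ubound; exists u.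
have := seminorm_ge0 x; rewrite le_eqVlt => /predU1P[x0|x0].
  rewrite -x0 mulr0 leNgt; apply/negP => fx0.
  have M0 : 0 <= M.
    by apply: le_trans (unitball x _); rewrite ?seminorm_ge0// -x0 ler01.
  have := unitball (((M + 1) / nrm (f x))%:C *: x).
  rewrite nrmZ -x0 mulr0 ler01 fZ nrmZ normcC.
  rewrite ger0_norm ?divr_ge0 ?addr_ge0 ?seminorm_ge0//.
  by rewrite divfK ?gt_eqF// => /(_ isT); lra.
have := unitball ((nrm x)^-1%:C *: x).
rewrite fZ !nrmZ normcC ger0_norm ?invr_ge0 ?seminorm_ge0//.
rewrite mulVf ?gt_eqF// => /(_ (lexx _)).
by rewrite mulrC ler_pdivrMr.
Qed.

(** At a time t0 where T halves norms, the norm of x is at most twice that of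
    x - V x for any V of the form z T(t0) with |z| <= 1. Split [0, t0] into N
    steps of length h and take z = (1 + i lam h)^-N, the implicit Euler factor
    in place of exp (- i lam t0). The difference telescopes into N terms, each
    the image under a uniformly bounded operator of
    (1 + i lam h) x - T(h) x = h (i lam x - (T(h) x - x) / h),
    and the last parenthesis tends to i lam x - A x as h -> 0. No integral of
    a vector-valued function is involved. *)
Lemma resolvent_bound (A : E -> E -> Prop) (T : R -> E -> E) :
  is_C0_semigroup nrm T -> generates nrm A T -> exp_stable nrm T ->
  exists K : R, forall x y (lam : R), A x y ->
    nrm x <= K * nrm ((0 +i* lam) *: x - y).
Proof.
move=> [Tlin _ T0 TD _] gen [C [om [C0 om0 Tdecay]]].
have [t0 t00 omt0] : exists2 t0, 0 < t0 & om * t0 = 2 * C.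
  exists (2 * C / om); first by rewrite !mulr_gt0 ?invr_gt0.
  by rewrite mulrC divfK ?gt_eqF.
have Tle t x : 0 <= t -> nrm (T t x) <= C * nrm x.
  move=> t0_; apply: (le_trans (le_op_norm _ _ _ (Tlin _ t0_) (Tdecay _ t0_))).
  rewrite ler_wpM2r ?seminorm_ge0// ger_pMr//.
  by rewrite -expR0 ler_expR oppr_le0 mulr_ge0// ltW.
have Thalf x : nrm (T t0 x) <= 2^-1 * nrm x.
  have t0_ : 0 <= t0 by exact: ltW.
  apply: (le_trans (le_op_norm _ _ _ (Tlin _ t0_) (Tdecay _ t0_))).
  rewrite ler_wpM2r ?seminorm_ge0// expRN ler_pdivrMr ?expR_gt0//.
  rewrite omt0.
  by have := expR_ge1Dx (2 * C); lra.
have K0 : 0 < 2 * (t0 * C) by rewrite !mulr_gt0.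
exists (2 * (t0 * C)) => x y lam Axy.
apply/ler_addgt0Pr => e e0.
set F := nrm (_ - y).
(* N is large enough for the difference quotient at h = t0 / N to be close
   to y. *)
have [N []] : exists N : nat, [/\ (0 < N)%N &
    nrm ((t0 / N%:R)^-1%:C *: (T (t0 / N%:R) x - x) - y) <= e / (2 * (t0 * C))].
  have /gen/cvgr0Pnorm_le/(_ (e / (2 * (t0 * C)))) := Axy.
  rewrite (divr_gt0 e0 K0) => /(_ isT) [d /= d0 dP].
  pose N := (Num.truncn (t0 / d)).+1.
  exists N; split => //.
  have hd : t0 / N%:R < d.
    by rewrite ltr_pdivrMr// mulrC -ltr_pdivrMr// /N truncnS_gt.
  have h0 : 0 < t0 / N%:R by rewrite divr_gt0.
  have := dP (t0 / N%:R); rewrite /= sub0r normrN gtr0_norm//.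
  by rewrite ger0_norm ?seminorm_ge0//; exact.
set h := t0 / _ => N0 step.
have h0 : 0 < h by rewrite divr_gt0// ltr0n.
pose zeta : R[i] := 1 +i* (lam * h).
have zeta1 : 1 <= normc zeta.
  by rewrite /= expr1n -[leLHS]sqrtr1 ler_wsqrtr// lerDl sqr_ge0.
have zeta0 : zeta != 0 by rewrite eq_complex /= oner_eq0.
have z1 j : normc ((zeta^-1) ^+ j) <= 1.
  elim: j => [|j IH]; first by rewrite expr0 ComplexField.Normc.normc1.
  rewrite exprS ComplexField.Normc.normcM ComplexField.Normc.normcV.
  have := IH; have : 0 <= normc ((zeta^-1) ^+ j).
    by case: (_ ^+ j) => ? ?; exact: sqrtr_ge0.
  have : (normc zeta)^-1 <= 1 by rewrite invf_le1// (lt_le_trans _ zeta1).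
  have : 0 <= (normc zeta)^-1 by rewrite invr_ge0 (le_trans _ zeta1).
  nra.
pose S j := (zeta^-1) ^+ j *: T (h *+ j) x.
have S1 : nrm (x - zeta^-1 *: T h x) <= h * (F + e / (2 * (t0 * C))).
  have -> : x - zeta^-1 *: T h x =
      (zeta^-1 * h%:C) *: (((0 +i* lam) *: x - y) - (h^-1%:C *: (T h x - x) - y)).
    rewrite opprB addrA subrK -scalerA.
    rewrite -[X in X - _ = _]scale1r -(mulVf zeta0) -scalerA -scalerBr.
    congr (_ *: _).
    rewrite !scalerBr !scalerA -rmorphM /= mulfV ?gt_eqF// !scale1r opprB addrA.
    congr (_ - _); rewrite -[X in _ + X]scale1r -scalerDl; congr (_ *: _).
    by apply/eqP; rewrite eq_complex /=; apply/andP; split; apply/eqP; ring.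
  have := z1 1; rewrite expr1 -scalerA => z1'.
  apply: le_trans (nrmZ_le _ _ z1') _.
  rewrite nrmZ normcC gtr0_norm// ler_wpM2l ?(ltW h0)//.
  by apply: le_trans (nrmD _ _) _; rewrite nrmN lerD2l.
have tel j : nrm (x - S j) <= j%:R * (C * (h * (F + e / (2 * (t0 * C))))).
  elim: j => [|j IH].
    rewrite /S mulr0n T0 expr0 scale1r subrr mul0r -(scale0r 0) nrmZ.
    by rewrite ComplexField.Normc.normc0 mul0r.
  have jh : 0 <= h *+ j by rewrite mulrn_wge0// ltW.
  have -> : x - S j.+1 =
      (x - S j) + (zeta^-1) ^+ j *: T (h *+ j) (x - zeta^-1 *: T h x).
    have -> : T (h *+ j) (x - zeta^-1 *: T h x) =
        T (h *+ j) x - zeta^-1 *: T (h *+ j) (T h x).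
      rewrite addrC -scaleNr (Tlin _ jh (- zeta^-1) (T h x) x) scaleNr.
      by rewrite addrC.
    rewrite -TD// ?ltW// /S mulrSr exprSr scalerBr addrA subrK scalerA.
    by [].
  apply: le_trans (nrmD _ _) _; rewrite -natr1 mulrDl mul1r lerD//.
  apply: le_trans (nrmZ_le _ _ (z1 j)) _.
  by apply: le_trans (Tle _ _ jh) _; rewrite ler_wpM2l ?(ltW C0).
have Nh : h *+ N = t0 by rewrite -mulr_natr /h divfK// pnatr_eq0 -lt0n.
have := tel N.
have : N%:R * (C * (h * (F + e / (2 * (t0 * C))))) = C * t0 * F + e / 2.
  transitivity ((h *+ N) * C * (F + e / (2 * (t0 * C)))).
    by rewrite -mulr_natr; ring.
  by rewrite Nh; field; rewrite !gt_eqF.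
move=> -> telN.
have : nrm x <= nrm (x - S N) + nrm (S N) by rewrite -{1}(subrK (S N) x).
have : nrm (S N) <= 2^-1 * nrm x.
  by rewrite /S Nh; apply: le_trans (nrmZ_le _ _ (z1 N)) _.
move: telN; lra.
Qed.

End ResolventBound.

(** * Test functions approximating the indicator of an interval *)
Section TestFunctions.
Local Open Scope classical_set_scope.
Local Open Scope ring_scope.
Context {R : realType}.

Lemma is_derive_sqr_max0 (x : R) :
  is_derive x 1 (fun s : R => Num.max 0 s ^+ 2) (2 * Num.max 0 x).
Proof.
have [x0|x0|<-] := ltgtP 0 x.
- apply: (@near_eq_is_derive R R^o R^o (fun s => s ^+ 2)).
    by near=> s; rewrite max_r// ltW//; near: s; exact: lt_nbhsr.
  apply: is_derive_eq; rewrite /GRing.scale /= ; ring.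
- apply: (@near_eq_is_derive R R^o R^o (cst 0)).
    near=> s; rewrite max_l ?expr0n// ltW//; near: s; exact: lt_nbhsl.
  by apply: is_derive_eq; rewrite mulr0.
- apply/is_derive1_caratheodory; exists (Num.max 0); split.
  + move=> z; rewrite maxxx expr0n /= !subr0.
    by have [z0|z0] := leP 0 z; rewrite ?expr2 ?expr0n ?mul0r.
  + by apply: continuous_max; [exact: cst_continuous|exact: cvg_id].
  + by rewrite maxxx mulr0.
Unshelve. all: by end_near.
Qed.

(** As n grows, 1 - 1 / (1 + n q) increases to the indicator of the set where
    q > 0. Squaring the positive part of (x - a) (b - x) makes q, and hence
    the quotient, continuously differentiable. *)
Definition bump (a b : R) (n : nat) (x : R) : R :=
  1 - (1 + n%:R * Num.max 0 ((x - a) * (b - x)) ^+ 2)^-1.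

Let bump_den a b n (x : R) : 0 < 1 + n%:R * Num.max 0 ((x - a) * (b - x)) ^+ 2.
Proof. by rewrite ltr_wpDr// mulr_ge0// sqr_ge0. Qed.

Lemma bump_ge0_le1 a b n x : 0 <= bump a b n x <= 1.
Proof.
rewrite subr_ge0 gerBl invr_ge0 (ltW (bump_den _ _ _ _)) andbT.
by rewrite invf_le1 ?bump_den// lerDl mulr_ge0// sqr_ge0.
Qed.

Lemma bump_out a b n x : ~~ (a < x < b) -> a < b -> bump a b n x = 0.
Proof.
move=> xab ab; rewrite /bump max_l ?expr0n ?mulr0 ?addr0 ?invr1 ?subrr//.
by move: xab; rewrite negb_and -!leNgt => /orP[|] ?; nra.
Qed.

Lemma bump_cvg a b x : a < b ->
  bump a b n x @[n --> \oo] --> (\1_`]a, b[ x : R).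
Proof.
move=> ab; rewrite indicE mem_setE in_itv /=.
have [xab|xab] := boolP (a < x < b); last first.
  by under eq_fun do rewrite bump_out//; exact: cvg_cst.
rewrite /bump /= -[X in _ --> X]subr0; apply: cvgB; first exact: cvg_cst.
have q0 : 0 < Num.max 0 ((x - a) * (b - x)) ^+ 2.
  case/andP: xab => ax xb; rewrite max_r ?exprn_gt0 ?mulr_gt0 ?subr_gt0//.
  by rewrite ltW// mulr_gt0 ?subr_gt0.
apply/cvgrPdist_le => e e0; near=> n.
rewrite sub0r normrN gtr0_norm ?invr_gt0 ?bump_den//.
rewrite invf_ple ?posrE ?bump_den//.
apply: (@le_trans _ _ (n%:R * Num.max 0 ((x - a) * (b - x)) ^+ 2));
  last by rewrite lerDr.
rewrite -ler_pdivrMr//; near: n; exact: nbhs_infty_ger.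
Unshelve. all: by end_near.
Qed.

Let bump' (a b : R) (n : nat) (x : R) : R :=
  (1 + n%:R * Num.max 0 ((x - a) * (b - x)) ^+ 2) ^- 2 *
  (n%:R * (2 * Num.max 0 ((x - a) * (b - x)) * (a + b - 2 * x))).

Let is_derive_bump a b n (x : R) : is_derive x 1 (bump a b n) (bump' a b n x).
Proof.
have dq : is_derive x 1 (fun y : R => (y - a) * (b - y)) (a + b - 2 * x).
  by apply: is_derive_eq; rewrite /GRing.scale /=; ring.
have dm := @is_derive1_comp _ _ _ x _ _ (is_derive_sqr_max0 _) dq.
have dn : is_derive x 1
    (fun y => 1 + n%:R * Num.max 0 ((y - a) * (b - y)) ^+ 2)
    (n%:R * (2 * Num.max 0 ((x - a) * (b - x)) * (a + b - 2 * x))).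
  have d1 := is_deriveD (is_derive_cst (1 : R) x 1) (is_deriveZ n%:R dm).
  by apply: is_derive_eq; rewrite add0r.
have dV := @is_deriveV R (fun y => 1 + n%:R * Num.max 0 ((y - a) * (b - y)) ^+ 2)
  x _ 1 (lt0r_neq0 (bump_den a b n x)) dn.
have := is_deriveB (is_derive_cst (1 : R) x 1) dV.
by move=> ?; apply: is_derive_eq; rewrite sub0r /bump' /GRing.scale /= mulNr opprK.
Qed.

Lemma bump_test_fun a b n : 0 < a -> a < b -> b < 1 -> test_fun (bump a b n).
Proof.
move=> a0 ab b1; split.
- by move=> x; have := is_derive_bump a b n x => -[].
- have -> : derive1 (bump a b n) = bump' a b n.
    by apply/funext => x; rewrite derive1E; case: (is_derive_bump a b n x).
  have cm : continuous (fun x : R => Num.max 0 ((x - a) * (b - x))).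
    move=> x; apply: (@continuous_max R R^o (cst 0) (fun y => (y - a) * (b - y))).
      exact: cst_continuous.
    by apply: continuousM; apply: continuousB => //; exact: cst_continuous.
  move=> x; rewrite /bump'; apply: cvgM.
    apply: cvgV; first by rewrite expf_neq0// lt0r_neq0.
    suff c1 : 1 + n%:R * Num.max 0 ((y - a) * (b - y)) ^+ 2 @[y --> x] -->
        1 + n%:R * Num.max 0 ((x - a) * (b - x)) ^+ 2 by exact: (cvgM c1 c1).
    apply: cvgD; first exact: cvg_cst.
    by apply: cvgM; [exact: cvg_cst|exact: (cvgM (cm x) (cm x))].
  apply: cvgM; first exact: cvg_cst.
  apply: cvgM; first by apply: cvgM; [exact: cvg_cst|exact: cm].
  by apply: cvgB; [exact: cvg_cst|apply: cvgM; [exact: cvg_cst|]].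
- exists a, b; split => // x.
  apply: contra_neqT => xab; apply: bump_out => //.
  by apply: contra xab => /andP[/ltW-> /ltW->].
Qed.

End TestFunctions.

(** * The fundamental lemma of the calculus of variations *)
Section FundamentalLemma.
Local Open Scope classical_set_scope.
Local Open Scope ring_scope.
#[local] Existing Instance ae_mu_filter.
Context {R : realType}.
Local Notation mu := (@lebesgue_measure R).
Local Notation I01 := [set` `]0 : R, 1 : R[ ].

Let mI : measurable (I01 : set (measurableTypeR R)).
Proof. exact: measurable_itv. Qed.

Variable h : R -> R.
Hypothesis hi : mu.-integrable I01 (EFin \o h).
Hypothesis h0 : forall p, test_fun p -> \int[mu]_(x in I01) (h x * p x) = 0.

Let mh : measurable_fun I01 h.
Proof. by apply/measurable_EFinP; case/integrableP: hi. Qed.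

Let mtest p : test_fun p -> measurable_fun I01 (p : R -> R).
Proof.
case=> dp _ _; apply: measurable_funTS; apply: continuous_measurable_fun => x.
exact/differentiable_continuous/derivable1_diffP.
Qed.

(** Dominated convergence along the bumps, with the dominating function |h|. *)
Let test_itv a b : 0 < a -> a < b -> b < 1 ->
  \int[mu]_(x in `]a, b[) h x = 0.
Proof.
move=> a0 ab b1.
have sub : `]a, b[ `<=` I01.
  by apply: subset_itv; rewrite bnd_simp ltW.
have tp n : test_fun (bump a b n) by exact: bump_test_fun.
have hp_le n x : (`|(h x * bump a b n x)%:E| <= `|(h x)%:E|)%E.
  rewrite !abse_EFin lee_fin normrM ler_piMr//.
  by have /andP[p0 p1] := @bump_ge0_le1 R a b n x; rewrite ger0_norm.
have mhp n : measurable_fun I01 (fun x => (h x * bump a b n x)%:E).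
  by apply/measurable_EFinP; apply: measurable_funM => //; exact: mtest.
have ihp n : mu.-integrable I01 (fun x => (h x * bump a b n x)%:E).
  by apply: (le_integrable mI (mhp n) _ hi) => x _; exact: hp_le.
have int0 n : (\int[mu]_(x in I01) (h x * bump a b n x)%:E = 0)%E.
  rewrite -(fineK (integrable_fin_num mI (ihp n))).
  by congr EFin; exact: h0.
have mab : measurable_fun I01 (fun x => (h x * \1_`]a, b[ x)%:E).
  by apply/measurable_EFinP; apply: measurable_funM.
have cv : {ae mu, forall x, I01 x ->
    (h x * bump a b n x)%:E @[n --> \oo] --> (h x * \1_`]a, b[ x)%:E}.
  apply: aeW => x _; apply/fine_cvgP; split; first exact: nearW.
  by apply: cvgMl_tmp; exact: bump_cvg.
have ahp : {ae mu, forall x n, I01 x ->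
    (`|(h x * bump a b n x)%:E| <= (abse \o (EFin \o h)) x)%E}.
  by apply: aeW => x n _; exact: hp_le.
have [_ _] := @dominated_convergence _ _ R mu I01 mI
  (fun n x => (h x * bump a b n x)%:E) _ _ mhp mab cv (integrable_abse hi) ahp.
under eq_fun do rewrite int0.
move/(cvg_unique (@ereal_hausdorff R) (cvg_cst _)) => H.
rewrite -(setIidr sub) Rintegral_mkcondr /Rintegral -[RHS]/(fine 0%E) [in RHS]H.
congr fine; apply: eq_integral => x _.
by rewrite patchE indicE; case: ifPn; rewrite ?mulr1 ?mulr0.
Qed.

(** The indefinite integral of h is constant on ]0, 1[, and its derivative is
    almost everywhere h by Lebesgue differentiation. *)
Lemma test_fun_orthogonal_ae0 : {ae mu, forall x, I01 x -> h x = 0}.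
Proof.
pose g := h \_ I01.
have gi : mu.-integrable setT (EFin \o g).
  by rewrite /g -restrict_EFin; apply/(integrable_mkcond _ mI).
pose F x := \int[mu]_(t in `]-oo, x]) g t.
have FTC : {ae mu, forall x, derivable F x 1 /\ derive1 F x = g x}.
  apply: FTC1Ny => [y|]; first exact: integrableS gi.
  by apply: open_integrable_locally => //; exact: openT.
have Fcst x y : 0 < x -> x < y -> y < 1 -> F y = F x.
  move=> x0 xy y1; apply/eqP; rewrite -subr_eq0 /F; apply/eqP.
  rewrite Rintegral_itvB ?bnd_simp ?(ltW xy)//; last exact: integrableS gi.
  rewrite -Rintegral_itv_bndo_bndc; last exact: integrableS gi.
  rewrite -[RHS](test_itv _ _ x0 xy y1); apply: eq_Rintegral => t.
  rewrite inE /= in_itv /= => /andP[xt ty].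
  by rewrite /g patchE mem_set//= in_itv /= (lt_trans x0)// (lt_trans ty).
move: FTC; apply: filterS => x [_ Fx]; rewrite /= in_itv /= => /andP[x0 x1].
have -> : h x = g x by rewrite /g patchE mem_set//= in_itv /= x0.
rewrite -Fx derive1E (@near_eq_derive R R^o R^o F (cst (F x))) ?derive_cst//.
near=> y; rewrite /cst /=; have [yx|xy|->//] := ltgtP y x.
  by symmetry; apply: Fcst => //; near: y; exact: lt_nbhsr.
by apply: Fcst => //; near: y; exact: lt_nbhsl.
Unshelve. all: by end_near.
Qed.

End FundamentalLemma.

(** * Uniqueness of weak derivatives, and the square norm of L^2 *)
Section WeakDerivative.
Local Open Scope classical_set_scope.
Local Open Scope complex_scope.
Local Open Scope ring_scope.
#[local] Existing Instance ae_mu_filter.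
Context {R : realType}.
Local Notation mu := (@lebesgue_measure R).
Local Notation I01 := [set` `]0 : R, 1 : R[ ].
Local Notation re := (@complex.Re R).
Local Notation im := (@complex.Im R).
Implicit Types u v : L2 R.

Lemma L2_ae_eq u v :
  (u : R -> R[i]) = (v : R -> R[i]) %[ae mu in I01] -> u = v.
Proof. by move=> uv; rewrite -[u]reprK -[v]reprK; apply/eqP/L2_eqP. Qed.

Lemma L2_integrable u :
  mu.-integrable I01 (EFin \o (re \o u)) /\ mu.-integrable I01 (EFin \o (im \o u)).
Proof.
have [ri ii] := L2_mul_integrable u
  (@continuous_sqint R (fun=> 1) (@cst_continuous R R 1)).
split.
  rewrite (_ : re \o u = fun x => re (u x * (1 : R)%:C))//.
  by apply/funext => x; rewrite mulr1.
rewrite (_ : im \o u = fun x => im (u x * (1 : R)%:C))//.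
by apply/funext => x; rewrite mulr1.
Qed.

(** Testing against real functions separates real and imaginary parts, so the
    fundamental lemma applies to each of them. *)
Lemma L2_weak_eq0 u :
  (forall p, test_fun p -> cint (fun x => u x * (p x)%:C) = 0) -> u = 0.
Proof.
move=> u0; have [ri ii] := L2_integrable u.
have := @test_fun_orthogonal_ae0 R _ ri; have := @test_fun_orthogonal_ae0 R _ ii.
have reE p x : re (u x * (p x)%:C) = re (u x) * p x by rewrite reM /= mulr0 subr0.
have imE p x : im (u x * (p x)%:C) = im (u x) * p x by rewrite imM /= mulr0 add0r.
move=> im0 re0.
apply: L2_ae_eq; apply: filterS3 (@L2_0E R) (im0 _) (re0 _).
- move=> x /= + + + Ix => /(_ Ix) -> /(_ Ix) + /(_ Ix).
  by case: (u x) => r i /= -> ->.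
- move=> p /u0 /(congr1 im) /= u0p; rewrite -[RHS]u0p; apply: eq_Rintegral => x _.
  by rewrite imE.
- move=> p /u0 /(congr1 re) /= u0p; rewrite -[RHS]u0p; apply: eq_Rintegral => x _.
  by rewrite reE.
Qed.

Lemma is_wderiv_unique u v v' : is_wderiv u v -> is_wderiv u v' -> v = v'.
Proof.
move=> hv hv'; apply/eqP; rewrite -subr_eq0 addrC -scaleN1r; apply/eqP.
apply: L2_weak_eq0 => p tp; have [ps _] := test_fun_sqint tp.
by rewrite cint_linear// mulN1r -hv'// hv// addNr.
Qed.

Lemma wderivE u v : is_wderiv u v -> wderiv u = v.
Proof.
move=> uv; apply: (is_wderiv_unique u) => //.
by apply: (@xgetPex _ 0 [set v | is_wderiv u v]); exists v.
Qed.

Lemma H1_is_wderiv u : u \in @H1 R -> is_wderiv u (wderiv u).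
Proof. by move=> /asboolP[v uv]; rewrite (wderivE _ _ uv). Qed.

Lemma wderiv_linear a u v : u \in @H1 R -> v \in @H1 R ->
  wderiv (a *: u + v) = a *: wderiv u + wderiv v.
Proof.
by move=> hu hv; apply: wderivE; apply: is_wderiv_linear; exact: H1_is_wderiv.
Qed.

End WeakDerivative.

Section L2Norm.
Local Open Scope classical_set_scope.
Local Open Scope complex_scope.
Local Open Scope ring_scope.
#[local] Existing Instance ae_mu_filter.
Context {R : realType}.
Local Notation mu := (@lebesgue_measure R).
Local Notation I01 := [set` `]0 : R, 1 : R[ ].
Local Notation re := (@complex.Re R).
Local Notation im := (@complex.Im R).
Local Notation normc := ComplexField.Normc.normc.
Implicit Types u v : L2 R.

Let mI : measurable (I01 : set (measurableTypeR R)).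
Proof. exact: measurable_itv. Qed.

Lemma sqr_normc_reim (z : R[i]) : normc z ^+ 2 = re z ^+ 2 + im z ^+ 2.
Proof. by case: z => r i; rewrite sqr_sqrtr// addr_ge0// sqr_ge0. Qed.

Definition L2_normsq u : R := re (L2_dot u u).

Lemma L2_normsqE u : L2_normsq u = \int[mu]_(x in I01) (normc (u x) ^+ 2).
Proof.
apply: eq_Rintegral => x _; rewrite sqr_normc_reim reM.
by case: (u x) => r i /=; rewrite mulrN opprK !expr2.
Qed.

Lemma L2_normsq_ge0 u : 0 <= L2_normsq u.
Proof. by rewrite L2_normsqE; apply: Rintegral_ge0 => x _; exact: sqr_ge0. Qed.

Lemma sqint_normsq_integrable (f : R -> R[i]) : f \in @sqint R ->
  mu.-integrable I01 (EFin \o (fun x => normc (f x) ^+ 2)).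
Proof.
move=> /asboolP[_ _ fi].
rewrite (_ : (fun x => _) = (fun x => re (f x) ^+ 2 + im (f x) ^+ 2))//.
by apply/funext => x; rewrite sqr_normc_reim.
Qed.

Let normsq_integrable u :
  mu.-integrable I01 (EFin \o (fun x => normc (u x) ^+ 2)).
Proof. exact/sqint_normsq_integrable/L2_sqint. Qed.

Lemma L2_normsqZ a u : L2_normsq (a *: u) = normc a ^+ 2 * L2_normsq u.
Proof.
rewrite !L2_normsqE -RintegralZl//.
apply: ae_eq_Rintegral => //.
  have := integrableZl mI (normc a ^+ 2) (normsq_integrable u); exact.
have := L2_linE a u 0; rewrite addr0; apply: filterS2 (@L2_0E R) => x + + Ix.
by move=> /(_ Ix) -> /(_ Ix) ->; rewrite addr0 ComplexField.Normc.normcM exprMn.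
Qed.

(** This family of inequalities, indexed by s, is stable under weighted sums
    and composition with linear maps, and it implies the triangle inequality
    for the square root: it replaces the Cauchy-Schwarz inequality. *)
Lemma L2_normsq_young s u v : 0 < s ->
  L2_normsq (u + v) <= (1 + s) * L2_normsq u + (1 + s^-1) * L2_normsq v.
Proof.
move=> s0; rewrite !L2_normsqE.
have Zi (c : R) (w : L2 R) :
    mu.-integrable I01 (EFin \o (fun x => c * normc (w x) ^+ 2)).
  have := integrableZl mI c (normsq_integrable w); exact.
rewrite -(RintegralZl (1 + s))// -(RintegralZl (1 + s^-1))// -RintegralD//.
have uvE : (fun x => normc ((u + v : L2 R) x) ^+ 2) =
    (fun x => normc (u x + v x) ^+ 2) %[ae mu in I01].
  have := L2_linE 1 u v; rewrite scale1r; apply: filterS => x + Ix.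
  by move=> /(_ Ix) ->; rewrite mul1r.
have Di : mu.-integrable I01 (EFin \o
    (fun x => (1 + s) * normc (u x) ^+ 2 + (1 + s^-1) * normc (v x) ^+ 2)).
  have := integrableD mI (Zi (1 + s) u) (Zi (1 + s^-1) v); exact.
have uv_sqint : (fun x => u x + v x) \in @sqint R.
  exact: (rpredD (L2_sqint u) (L2_sqint v)).
rewrite (ae_eq_Rintegral _ _ uvE)//; last exact: sqint_normsq_integrable.
apply: le_Rintegral => //; first exact: sqint_normsq_integrable.
move=> x _; rewrite !sqr_normc_reim reD imD -subr_ge0.
move: (re (u x)) (im (u x)) (re (v x)) (im (v x)) => p q r t.
rewrite (_ : _ - _ = s^-1 * ((s * p - r) ^+ 2 + (s * q - t) ^+ 2)).
  by rewrite mulr_ge0 ?invr_ge0 ?(ltW s0)// addr_ge0 ?sqr_ge0.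
by field; rewrite gt_eqF.
Qed.

End L2Norm.

(** * The Bresse norm is a seminorm *)
Section BresseSeminorm.
Local Open Scope complex_scope.
Local Open Scope ring_scope.
Context {R : realType}.
Local Notation normc := ComplexField.Normc.normc.

(** What has to be known of a nonnegative quadratic form for its square root to
    be a seminorm, in a shape that makes no mention of a polar form. *)
Definition young_form (E : lmodType R[i]) (q : E -> R) : Prop :=
  [/\ forall x, 0 <= q x,
      forall a x, q (a *: x) = normc a ^+ 2 * q x
    & forall s x y, 0 < s -> q (x + y) <= (1 + s) * q x + (1 + s^-1) * q y].

Lemma young_formD (E : lmodType R[i]) (q1 q2 : E -> R) :
  young_form E q1 -> young_form E q2 -> young_form E (fun x => q1 x + q2 x).
Proof.
move=> [p1 Z1 Y1] [p2 Z2 Y2]; split=> [x|a x|s x y s0].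
- by rewrite addr_ge0.
- by rewrite Z1 Z2 mulrDr.
- by apply: le_trans (lerD (Y1 _ _ _ s0) (Y2 _ _ _ s0)) _; rewrite !mulrDr addrACA.
Qed.

Lemma young_form_L2 (E : lmodType R[i]) (c : R) (L : E -> L2 R) :
  0 < c -> linear L -> young_form E (fun x => c * L2_normsq (L x)).
Proof.
move=> c0 linL.
have L0 : L 0 = 0 by have := linL (-1) 0 0; rewrite scaler0 addr0 scaleN1r addNr.
split=> [x|a x|s x y s0].
- by rewrite mulr_ge0 ?L2_normsq_ge0 ?ltW.
- by have := linL a x 0; rewrite L0 !addr0 => ->; rewrite L2_normsqZ mulrCA.
- have := linL 1 x y; rewrite !scale1r => ->.
  rewrite (mulrCA (1 + s)) (mulrCA (1 + s^-1)) -mulrDr ler_wpM2l ?(ltW c0)//.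
  exact: L2_normsq_young.
Qed.

(** For p >= sqrt (q x) and r >= sqrt (q y) positive, the parameter s = r / p
    makes (p + r)^2 an upper bound of the right-hand side of the inequality. *)
Lemma young_seminorm (E : lmodType R[i]) (q : E -> R) :
  young_form E q -> is_seminorm R E (fun x => Num.sqrt (q x)).
Proof.
move=> [q0 qZ qY]; split=> [[a b] x|x y].
  by rewrite qZ sqrtrM ?sqr_ge0// sqrtr_sqr ger0_norm// sqrtr_ge0.
apply/ler_addgt0Pr => e e0.
(* Adding e / 2 keeps p and r positive when q x or q y vanishes. *)
set p := Num.sqrt (q x) + e / 2; set r := Num.sqrt (q y) + e / 2.
have [p0 r0] : 0 < p /\ 0 < r.
  by split; rewrite ltr_wpDl ?sqrtr_ge0// divr_gt0.
have qp : q x <= p ^+ 2.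
  rewrite -[q x]sqr_sqrtr// ler_sqr ?nnegrE ?sqrtr_ge0 ?(ltW p0)//.
  by rewrite lerDl divr_ge0// ltW.
have qr : q y <= r ^+ 2.
  rewrite -[q y]sqr_sqrtr// ler_sqr ?nnegrE ?sqrtr_ge0 ?(ltW r0)//.
  by rewrite lerDl divr_ge0// ltW.
have -> : Num.sqrt (q x) + Num.sqrt (q y) + e = p + r by rewrite /p /r; field.
rewrite -[leRHS](_ : Num.sqrt ((p + r) ^+ 2) = _); last first.
  by rewrite sqrtr_sqr (gtr0_norm (addr_gt0 p0 r0)).
apply: ler_wsqrtr.
have rp0 : 0 < r / p by rewrite divr_gt0.
apply: le_trans (qY _ x y rp0) _.
have -> : (p + r) ^+ 2 = (1 + r / p) * p ^+ 2 + (1 + (r / p)^-1) * r ^+ 2.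
  by field; rewrite !gt_eqF.
by apply: lerD; apply: ler_wpM2l => //; rewrite addr_ge0// ?invr_ge0 ltW.
Qed.

Variables rho1 rho2 b k k0 l : R.
Hypotheses (hrho1 : 0 < rho1) (hrho2 : 0 < rho2) (hb : 0 < b) (hk : 0 < k)
  (hk0 : 0 < k0).
Local Notation D := (@wderiv R).
Local Notation H := (bresse_space R).

Let phit1 (Phi : H) : L2 R := Phi.1.1.1.1.2.
Let psi1 (Phi : H) : H1s R := Phi.1.1.1.2.
Let psit1 (Phi : H) : L2s R := Phi.1.1.2.
Let wt1 (Phi : H) : L2s R := Phi.2.

Definition bresse_normsq (Phi : H) : R :=
  k * L2_normsq (shear l Phi) + k0 * L2_normsq (axial l Phi)
  + b * L2_normsq (D (psi1 Phi)) + rho1 * L2_normsq (phit1 Phi)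
  + rho2 * L2_normsq (psit1 Phi) + rho1 * L2_normsq (wt1 Phi).

Lemma bresse_normE Phi :
  bresse_norm rho1 rho2 b k k0 l Phi = Num.sqrt (bresse_normsq Phi).
Proof.
case: Phi => [[[[[phi phit] psi] psit] w] wt].
have reZ (r : R) z : complex.Re (r%:C * z) = r * complex.Re z.
  by rewrite reM /= mul0r subr0.
by rewrite /bresse_norm /bresse_dot /bresse_normsq !reD !reZ.
Qed.

Let H10_H1 (u : H10 R) : (u : L2 R) \in @H1 R.
Proof. by case: u => u /= /andP[]. Qed.

Let H1s_H1 (u : H1s R) : (u : L2 R) \in @H1 R.
Proof. by case: u => u /= /andP[]. Qed.

Let shear_linear : linear (shear l : H -> L2 R).
Proof.
move=> a [[[[[phi phit] psi] psit] w] wt] [[[[[phi2 phit2] psi2] psit2] w2] wt2].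
rewrite /shear /= wderiv_linear// !scalerDr !scalerA (mulrC l%:C a).
by rewrite (addrACA (a *: D phi)) [LHS]addrACA.
Qed.

Let axial_linear : linear (axial l : H -> L2 R).
Proof.
move=> a [[[[[phi phit] psi] psit] w] wt] [[[[[phi2 phit2] psi2] psit2] w2] wt2].
rewrite /axial /= wderiv_linear// scalerBr !scalerDr !scalerA (mulrC l%:C a).
by rewrite opprD addrACA.
Qed.

Let phit_linear : linear phit1.
Proof. by move=> a [[[[[? ?] ?] ?] ?] ?] [[[[[? ?] ?] ?] ?] ?]. Qed.

Let psit_linear : linear (psit1 : H -> L2 R).
Proof. by move=> a [[[[[? ?] ?] ?] ?] ?] [[[[[? ?] ?] ?] ?] ?]. Qed.

Let wt_linear : linear (wt1 : H -> L2 R).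
Proof. by move=> a [[[[[? ?] ?] ?] ?] ?] [[[[[? ?] ?] ?] ?] ?]. Qed.

Let Dpsi_linear : linear (fun Phi : H => D (psi1 Phi)).
Proof.
move=> a [[[[[phi phit] psi] psit] w] wt] [[[[[phi2 phit2] psi2] psit2] w2] wt2].
by rewrite /psi1 /= -(wderiv_linear a).
Qed.

Lemma bresse_norm_seminorm : is_seminorm R H (bresse_norm rho1 rho2 b k k0 l).
Proof.
have -> : bresse_norm rho1 rho2 b k k0 l =
    fun Phi => Num.sqrt (bresse_normsq Phi).
  by apply/funext => Phi; rewrite bresse_normE.
apply: young_seminorm; rewrite /bresse_normsq.
apply: young_formD; last exact: young_form_L2 wt_linear.
apply: young_formD; last exact: young_form_L2 psit_linear.
apply: young_formD; last exact: young_form_L2 phit_linear.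
apply: young_formD; last exact: young_form_L2 Dpsi_linear.
apply: young_formD; first exact: young_form_L2 shear_linear.
exact: young_form_L2 axial_linear.
Qed.

End BresseSeminorm.

(** * Continuous functions as elements of L^2 *)
Section ContinuousRepresentatives.
Local Open Scope classical_set_scope.
Local Open Scope complex_scope.
Local Open Scope ring_scope.
#[local] Existing Instance ae_mu_filter.
Context {R : realType}.
Local Notation mu := (@lebesgue_measure R).
Local Notation I01 := [set` `]0 : R, 1 : R[ ].
Local Notation re := (@complex.Re R).
Local Notation im := (@complex.Im R).

Definition L2_of (f : R -> R) (fc : continuous f) : L2 R :=
  \pi_(L2 R)%qT (MkL2fun (continuous_sqint fc)).

Lemma L2_ofE (f : R -> R) (fc : continuous f) :
  (L2_of f fc : R -> R[i]) = (fun x => (f x)%:C) %[ae mu in I01].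
Proof. exact: L2_pi_ae. Qed.

Lemma continuous_integrable (f : R -> R) : continuous f ->
  mu.-integrable I01 (EFin \o f).
Proof.
move=> fc; apply: (@integrableS _ _ _ mu `[0, 1]) => //.
  exact: subset_itv_oo_cc.
apply: continuous_compact_integrable; first exact: segment_compact.
exact: continuous_subspaceT.
Qed.

Lemma Rintegral01_oo_cc (f : R -> R) : continuous f ->
  \int[mu]_(x in I01) f x = \int[mu]_(x in `[0, 1]) f x.
Proof.
move=> fc; rewrite Rintegral_itv_obnd_cbnd; last exact: continuous_integrable.
rewrite Rintegral_itv_bndo_bndc//; apply: (@integrableS _ _ _ mu `[0, 1]) => //.
  by apply: subset_itvl; rewrite bnd_simp.
apply: continuous_compact_integrable; first exact: segment_compact.
exact: continuous_subspaceT.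
Qed.

Lemma cint_L2_of_mul (f : R -> R) (fc : continuous f) (g : R -> R) : continuous g ->
  cint (fun x => L2_of f fc x * (g x)%:C) = (\int[mu]_(x in I01) (f x * g x))%:C.
Proof.
move=> gc.
have [ri ii] := L2_mul_integrable (L2_of f fc) (continuous_sqint gc).
have fgi : mu.-integrable I01 (EFin \o (fun x => f x * g x)).
  by apply: continuous_integrable => x; apply: cvgM; [exact: fc|exact: gc].
congr Complex.
  apply: ae_eq_Rintegral => //; apply: filterS (L2_ofE f fc) => x + Ix.
  by move=> /(_ Ix) ->; rewrite reM /= mul0r subr0.
have int0 : \int[mu]_(x in I01) 0 = 0 :> R.
  by rewrite Rintegral_cst ?mul0r//; exact: measurable_itv.
rewrite -[RHS]int0; apply: ae_eq_Rintegral => //.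
  by apply: continuous_integrable => x; exact: cvg_cst.
apply: filterS (L2_ofE f fc) => x + Ix.
by move=> /(_ Ix) ->; rewrite imM /= mul0r mulr0 addr0.
Qed.

Lemma cint_L2_of (f : R -> R) (fc : continuous f) :
  cint (L2_of f fc) = (\int[mu]_(x in I01) f x)%:C.
Proof.
transitivity (cint (fun x => L2_of f fc x * ((fun=> 1) x : R)%:C)).
  by congr cint; apply/funext => x; rewrite mulr1.
rewrite cint_L2_of_mul; last exact: cst_continuous.
by congr (_%:C); apply: eq_Rintegral => x _; rewrite mulr1.
Qed.

Lemma L2_normsq_of (f : R -> R) (fc : continuous f) :
  L2_normsq (L2_of f fc) = \int[mu]_(x in I01) (f x ^+ 2).
Proof.
have fi : mu.-integrable I01 (EFin \o (fun x => f x ^+ 2)).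
  by apply: continuous_integrable => x; exact: (cvgM (fc x) (fc x)).
rewrite L2_normsqE; apply: ae_eq_Rintegral => //.
  exact/sqint_normsq_integrable/L2_sqint.
apply: filterS (L2_ofE f fc) => x + Ix => /(_ Ix) ->.
by rewrite sqr_normc_reim /= expr0n addr0.
Qed.

Lemma bdval_L2_of (f : R -> R) (fc : continuous f) (x : R) :
  bdval (L2_of f fc) x (f x)%:C.
Proof.
exists (fun y => (f y)%:C); split => //; last exact: L2_ofE.
apply: continuous_subspaceT => y; apply/cvgrPdist_lt => e e0.
have [r r0 ->] : exists2 r : R, 0 < r & e = r%:C.
  by case: e e0 => r i; rewrite ltcE /= => /andP[/eqP-> r0]; exists r.
have /cvgrPdist_lt/(_ _ r0) := fc y; apply: filterS => z fyz.
rewrite -(rmorphB (real_complex R)) normc_def /=.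
by rewrite expr0n addr0 sqrtr_sqr ltcR.
Qed.

(** Integration by parts on [0, 1]; test functions vanish at both ends. *)
Lemma is_wderiv_L2_of (f : R -> R) (fc : continuous f) (f' : R -> R)
    (fc' : continuous f') :
  (forall x : R, is_derive x 1 f (f' x)) -> is_wderiv (L2_of f fc) (L2_of f' fc').
Proof.
move=> df p [dp cp [a [b [a0 b1 pab]]]].
have pc : continuous p.
  by move=> x; exact/differentiable_continuous/derivable1_diffP.
have p0 : p 0 = 0.
  by apply/eqP; apply: contraT => /pab /andP[/(lt_le_trans a0)]; rewrite ltxx.
have p1 : p 1 = 0.
  by apply/eqP; apply: contraT => /pab /andP[_ /le_lt_trans/(_ b1)]; rewrite ltxx.
rewrite !cint_L2_of_mul// -rmorphN /=; congr (_%:C).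
have cc (g h : R -> R) : continuous g -> continuous h ->
    \int[mu]_(x in I01) (g x * h x) = \int[mu]_(x in `[0, 1]) (g x * h x).
  move=> gc hc; apply: Rintegral01_oo_cc => x.
  by apply: cvgM; [exact: gc|exact: hc].
have oo (g : R -> R) : (forall x, derivable g x 1) ->
    derivable_oo_LRcontinuous g 0 1.
  move=> dg; have gc x : g y @[y --> x] --> g x.
    exact/differentiable_continuous/derivable1_diffP.
  split; [by move=> x _; exact: dg|exact: cvg_at_right_filter|].
  exact: cvg_at_left_filter.
rewrite !cc//.
have := @Rintegration_by_parts R f p f' (derive1 p) 0 1 ltr01.
rewrite p0 p1 !mulr0 subrr sub0r; apply => //.
- exact: continuous_subspaceT.
- by apply: oo => x; case: (df x).
- by move=> x _; rewrite derive1E; case: (df x).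
- exact: continuous_subspaceT.
- exact: oo.
Qed.

End ContinuousRepresentatives.

(** * The trigonometric modes *)
Section SineCosineModes.
Local Open Scope classical_set_scope.
Local Open Scope complex_scope.
Local Open Scope ring_scope.
#[local] Existing Instance ae_mu_filter.
Context {R : realType}.
Local Notation mu := (@lebesgue_measure R).
Local Notation I01 := [set` `]0 : R, 1 : R[ ].
Local Notation normc := ComplexField.Normc.normc.
Local Notation D := (@wderiv R).

Lemma Rintegral01_derive (F f : R -> R) : continuous f ->
  (forall x : R, is_derive x 1 F (f x)) ->
  \int[mu]_(x in I01) f x = F 1 - F 0.
Proof.
move=> fc dF.
have Fc x : F y @[y --> x] --> F x.
  by apply/differentiable_continuous/derivable1_diffP; case: (dF x).
rewrite Rintegral01_oo_cc// /Rintegral (@continuous_FTC2 _ f F 0 1)//.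
- exact: continuous_subspaceT.
- split; first by move=> x _; case: (dF x).
  + exact: cvg_at_right_filter.
  + exact: cvg_at_left_filter.
- by move=> x _; rewrite derive1E; case: (dF x).
Qed.

Lemma L2_of_scale (f g : R -> R) (fc : continuous f) (gc : continuous g)
    (r : R) :
  (forall x, g x = r * f x) -> L2_of g gc = r%:C *: L2_of f fc.
Proof.
move=> gE; apply/eqP; rewrite -[_ *: _]/(L2_scale _ _) L2_pi_scale.
by apply/L2_eqP; apply: aeW => x _; rewrite /= gE rmorphM.
Qed.

Lemma sin_npi (n : nat) : sin (n%:R * pi) = 0 :> R.
Proof.
elim: n => [|n IH]; first by rewrite mul0r sin0.
by rewrite -natr1 mulrDl mul1r sinDpi IH oppr0.
Qed.

Variable n : nat.

Definition freq : R := n.+1%:R * pi.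
Local Notation m := freq.

Lemma freq_gt0 : 0 < m. Proof. by rewrite mulr_gt0// pi_gt0. Qed.

Let mn0 : m != 0. Proof. by rewrite gt_eqF// freq_gt0. Qed.

Let sinm (x : R) : R := sin (m * x).
Let cosm (x : R) : R := cos (m * x).

Let dlin (x : R) : is_derive x 1 (fun y : R => m * y) m.
Proof. by apply: is_derive_eq; rewrite /GRing.scale /= mulr1. Qed.

Let dsinm (x : R) : is_derive x 1 sinm (m * cosm x).
Proof.
rewrite mulrC.
exact: (@is_derive1_comp _ _ _ x _ _ (is_derive_sin _) (dlin x)).
Qed.

Let dcosm (x : R) : is_derive x 1 cosm (- m * sinm x).
Proof.
rewrite mulNr mulrC -mulNr.
exact: (@is_derive1_comp _ _ _ x _ _ (is_derive_cos _) (dlin x)).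
Qed.

Let csinm : continuous sinm.
Proof.
by move=> x; apply/differentiable_continuous/derivable1_diffP; case: (dsinm x).
Qed.

Let ccosm : continuous cosm.
Proof.
by move=> x; apply/differentiable_continuous/derivable1_diffP; case: (dcosm x).
Qed.

Definition sin_mode : L2 R := L2_of sinm csinm.
Definition cos_mode : L2 R := L2_of cosm ccosm.

Lemma is_wderiv_sin_mode a : is_wderiv (a *: sin_mode) ((m%:C * a) *: cos_mode).
Proof.
have cd : continuous (fun x => m * cosm x).
  by move=> x; apply: cvgM; [exact: cvg_cst|exact: ccosm].
have h := is_wderiv_L2_of sinm csinm _ cd dsinm.
have := is_wderiv_linear a h (@is_wderiv0 R).
by rewrite !addr0 (L2_of_scale _ _ ccosm cd m)// scalerA mulrC.
Qed.

Lemma is_wderiv_cos_mode a :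
  is_wderiv (a *: cos_mode) ((- m%:C * a) *: sin_mode).
Proof.
have cd : continuous (fun x => - m * sinm x).
  by move=> x; apply: cvgM; [exact: cvg_cst|exact: csinm].
have h := is_wderiv_L2_of cosm ccosm _ cd dcosm.
have := is_wderiv_linear a h (@is_wderiv0 R).
by rewrite !addr0 (L2_of_scale _ _ csinm cd (- m))// scalerA mulrC rmorphN.
Qed.

Let sin1 : sinm 1 = 0. Proof. by rewrite /sinm mulr1 sin_npi. Qed.
Let sin00 : sinm 0 = 0. Proof. by rewrite /sinm mulr0 sin0. Qed.

Lemma bdval_sin_mode a : bdval (a *: sin_mode) 0 0 /\ bdval (a *: sin_mode) 1 0.
Proof.
have bd x : sinm x = 0 -> bdval (a *: sin_mode) x 0.
  move=> sx; have := bdval_linear a (bdval_L2_of sinm csinm x) (bdval0 x).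
  by rewrite !addr0 sx mulr0.
by split; apply: bd.
Qed.

Lemma cint_cos_mode : cint cos_mode = 0.
Proof.
have d (x : R) : is_derive x 1 (fun y => m^-1 * sinm y) (cosm x).
  have := is_deriveZ m^-1 (dsinm x).
  by rewrite /GRing.scale /= mulrA mulVf// mul1r.
by rewrite cint_L2_of (Rintegral01_derive _ _ ccosm d) sin1 sin00 !mulr0 subrr.
Qed.

Let dsincos (x : R) : is_derive x 1 (fun y => (2 * m)^-1 * (sinm y * cosm y))
  (2^-1 * (cosm x ^+ 2 - sinm x ^+ 2)).
Proof.
have := is_deriveZ (2 * m)^-1 (is_deriveM (dsinm x) (dcosm x)).
move=> d; apply: is_derive_eq; rewrite /GRing.scale /=.
by field.
Qed.

(** Antiderivatives of sin^2 and cos^2 are x / 2 -+ sin cos / (2 mu), and the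
    second term vanishes at 0 and at 1. *)
Lemma L2_normsq_sin_mode a : L2_normsq (a *: sin_mode) = 2^-1 * normc a ^+ 2.
Proof.
rewrite L2_normsqZ L2_normsq_of mulrC; congr (_ * _).
have d (x : R) : is_derive x 1
    (fun y => 2^-1 * y - (2 * m)^-1 * (sinm y * cosm y)) (sinm x ^+ 2).
  have := dsincos x => d; apply: is_derive_eq; rewrite /GRing.scale /=.
  have := cos2Dsin2 (m * x); rewrite /sinm /cosm; lra.
have c2 : continuous (fun x => sinm x ^+ 2).
  by move=> x; exact: (cvgM (csinm x) (csinm x)).
by rewrite (Rintegral01_derive _ _ c2 d) sin1 sin00 !mul0r !mulr0 !subr0 mulr1.
Qed.

Lemma L2_normsq_cos_mode a : L2_normsq (a *: cos_mode) = 2^-1 * normc a ^+ 2.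
Proof.
rewrite L2_normsqZ L2_normsq_of mulrC; congr (_ * _).
have d (x : R) : is_derive x 1
    (fun y => 2^-1 * y + (2 * m)^-1 * (sinm y * cosm y)) (cosm x ^+ 2).
  have := dsincos x => d; apply: is_derive_eq; rewrite /GRing.scale /=.
  have := cos2Dsin2 (m * x); rewrite /sinm /cosm; lra.
have c2 : continuous (fun x => cosm x ^+ 2).
  by move=> x; exact: (cvgM (ccosm x) (ccosm x)).
by rewrite (Rintegral01_derive _ _ c2 d) sin1 sin00 !mul0r !mulr0 !addr0 subr0 mulr1.
Qed.

End SineCosineModes.

(** * The Bresse operator on a frequency *)
Section BresseModes.
Local Open Scope complex_scope.
Local Open Scope ring_scope.
Context {R : realType}.
Local Notation normc := ComplexField.Normc.normc.
Local Notation D := (@wderiv R).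
Variable n : nat.
Local Notation m := (@freq R n).
Local Notation S := (@sin_mode R n).
Local Notation C := (@cos_mode R n).

Let D_sin a : D (a *: S) = (m%:C * a) *: C.
Proof. exact/wderivE/is_wderiv_sin_mode. Qed.

Let D_cos a : D (a *: C) = (- m%:C * a) *: S.
Proof. exact/wderivE/is_wderiv_cos_mode. Qed.

Let sin_H1 a : a *: S \in @H1 R.
Proof. by apply/asboolP; eexists; exact: is_wderiv_sin_mode. Qed.

Let cos_H1 a : a *: C \in @H1 R.
Proof. by apply/asboolP; eexists; exact: is_wderiv_cos_mode. Qed.

Let sin_H2 a : a *: S \in @H2 R.
Proof. by rewrite inE D_sin sin_H1 cos_H1. Qed.

Let cos_H2 a : a *: C \in @H2 R.
Proof. by rewrite inE D_cos sin_H1 cos_H1. Qed.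

Let sin_H10 a : a *: S \in @H10_pred R.
Proof. by apply/andP; split => //; apply/asboolP; exact: bdval_sin_mode. Qed.

Let cos_L2s a : a *: C \in @L2s_pred R.
Proof. by rewrite rpredZ//; apply/eqP; exact: cint_cos_mode. Qed.

Let cos_H1s a : a *: C \in @H1s_pred R.
Proof. by apply/andP; split. Qed.

(** The six coefficients are those of [phi], [psi] and [w], each followed by
    that of its velocity. *)
Definition mode (a a' c c' d d' : R[i]) : bresse_space R :=
  (MkH10 (sin_H10 a), a' *: S, MkH1s (cos_H1s c), MkL2s (cos_L2s c'),
   MkH1s (cos_H1s d), MkL2s (cos_L2s d')).

Lemma mode_lin z a a' c c' d d' e e' f f' g g' :
  z *: mode a a' c c' d d' - mode e e' f f' g g' =
  mode (z * a - e) (z * a' - e') (z * c - f) (z * c' - f')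
       (z * d - g) (z * d' - g').
Proof.
have E (u : L2 R) x y : (z * x - y) *: u = z *: (x *: u) - y *: u.
  by rewrite scalerBl scalerA.
have E1 x y : MkH10 (sin_H10 (z * x - y)) =
    z *: MkH10 (sin_H10 x) - MkH10 (sin_H10 y).
  by apply: val_inj; exact: E.
have E2 x y : MkH1s (cos_H1s (z * x - y)) =
    z *: MkH1s (cos_H1s x) - MkH1s (cos_H1s y).
  by apply: val_inj; exact: E.
have E3 x y : MkL2s (cos_L2s (z * x - y)) =
    z *: MkL2s (cos_L2s x) - MkL2s (cos_L2s y).
  by apply: val_inj; exact: E.
by rewrite /mode E1 E !E2 !E3.
Qed.

Variables rho1 rho2 b k k0 l delta : R.

Lemma shear_mode a a' c c' d d' :
  shear l (mode a a' c c' d d') = (m%:C * a + c + l%:C * d) *: C.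
Proof. by rewrite /shear /= D_sin scalerA !scalerDl. Qed.

Lemma axial_mode a a' c c' d d' :
  axial l (mode a a' c c' d d') = (- (m%:C * d + l%:C * a)) *: S.
Proof.
rewrite /axial /= D_cos scalerA opprD scalerDl.
by rewrite mulNr scaleNr [in RHS]scaleNr.
Qed.

Lemma bresse_normsq_mode a a' c c' d d' :
  bresse_normsq rho1 rho2 b k k0 l (mode a a' c c' d d') =
  2^-1 * (k * normc (m%:C * a + c + l%:C * d) ^+ 2
    + k0 * normc (- (m%:C * d + l%:C * a)) ^+ 2
    + b * normc (- m%:C * c) ^+ 2 + rho1 * normc a' ^+ 2
    + rho2 * normc c' ^+ 2 + rho1 * normc d' ^+ 2).
Proof.
rewrite /bresse_normsq shear_mode axial_mode /= D_cos.
rewrite !L2_normsq_sin_mode !L2_normsq_cos_mode.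
by ring.
Qed.

(** Differentiation exchanges sines and cosines, so the operator acts on the
    six coefficients by a matrix. *)
Lemma bresse_op_mode a a' c c' d d' :
  bresse_op rho1 rho2 b k k0 l delta (mode a a' c c' d d')
    (mode a' ((k / rho1)%:C * (- m%:C * (m%:C * a + c + l%:C * d))
              + (l * k0 / rho1)%:C * (- (m%:C * d + l%:C * a))
              - (delta / rho1)%:C * a')
          c' ((b / rho2)%:C * (m%:C * (- m%:C * c))
              - (k / rho2)%:C * (m%:C * a + c + l%:C * d))
          d' ((k0 / rho1)%:C * (m%:C * (- (m%:C * d + l%:C * a)))
              - (l * k / rho1)%:C * (m%:C * a + c + l%:C * d))).
Proof.
split; last first.
  rewrite /mode; split; split => //.
  - rewrite -/(mode a a' c c' d d') shear_mode axial_mode D_cos.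
    by rewrite !scalerA -scalerDl -scalerBl.
  - rewrite -/(mode a a' c c' d d') shear_mode /= D_cos D_sin.
    by rewrite !scalerA -scalerBl.
  - rewrite -/(mode a a' c c' d d') shear_mode axial_mode /= D_sin.
    by rewrite !scalerA -scalerBl.
split; first by split; [exact: sin_H2|exact: cos_H2|exact: cos_H2].
split; first by split; [exact: sin_H10|exact: cos_H1s|exact: cos_H1s].
by rewrite /= !D_cos; have [? ?] := bdval_sin_mode n (- m%:C * c);
  have [? ?] := bdval_sin_mode n (- m%:C * d); split.
Qed.

End BresseModes.

(** * Quasimodes *)
Section Quasimodes.
Local Open Scope complex_scope.
Local Open Scope ring_scope.
Context {R : realType}.
Variables rho1 rho2 b k k0 l delta : R.
Hypotheses (hrho1 : 0 < rho1) (hrho2 : 0 < rho2) (hb : 0 < b) (hk : 0 < k)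
  (hk0 : 0 < k0).
Local Notation normc := ComplexField.Normc.normc.
Local Notation nrm := (bresse_norm rho1 rho2 b k k0 l).

(** Resonance conditions: the vanishing of the coefficients of the unbounded
    powers of the frequency in the residual. The three cases of the proof are
    the vibration of [psi] at its own speed, that of [w] at its own speed, and
    for equal speeds, a combination of [psi] and [w] that leaves [phi] at
    rest. *)
Lemma quasimode_amplitudes : exists alpha gamma eta sigma : R,
  [/\ 0 < sigma, 0 < rho2 * gamma ^+ 2 + rho1 * eta ^+ 2 &
  [/\ alpha * (k - rho1 * sigma ^+ 2) + k * gamma + l * (k + k0) * eta = 0,
      gamma * (b - rho2 * sigma ^+ 2) = 0
    & eta * (k0 - rho1 * sigma ^+ 2) = 0]].
Proof.
have sq r s : 0 < r -> 0 < s -> Num.sqrt (r / s) ^+ 2 = r / s.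
  by move=> r0 s0; rewrite sqr_sqrtr// divr_ge0 ?ltW.
have sq0 r s : 0 < r -> 0 < s -> 0 < Num.sqrt (r / s).
  by move=> r0 s0; rewrite sqrtr_gt0 divr_gt0.
have [n1 n2] : rho1 != 0 /\ rho2 != 0 by rewrite !gt_eqF.
have [kb|kb] := eqVneq (k * rho2) (rho1 * b); last first.
  have dn : k - rho1 * (b / rho2) != 0.
    apply: contra kb => /eqP kb; apply/eqP.
    have -> : k * rho2 = (k - rho1 * (b / rho2)) * rho2 + rho1 * b by field.
    by rewrite kb mul0r add0r.
  exists (- k / (k - rho1 * (b / rho2))), 1, 0, (Num.sqrt (b / rho2)).
  rewrite sq// expr1n expr0n /= !mulr0 mulr1 !addr0 mul0r.
  split; [exact: sq0|by []|split] => //.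
    by rewrite divfK//; ring.
  by field.
have [kk|kk] := eqVneq k k0; last first.
  have dn : k - k0 != 0 by rewrite subr_eq0.
  exists (- (l * (k + k0)) / (k - k0)), 0, 1, (Num.sqrt (k0 / rho1)).
  rewrite sq// expr1n expr0n /= !mulr0 mulr1 add0r mul0r.
  split; [exact: sq0|by []|split] => //.
    by field; rewrite n1 dn.
  by field.
exists 0, (- (2 * l)), 1, (Num.sqrt (k / rho1)).
rewrite sq// -kk; split; [exact: sq0| |split].
- by rewrite expr1n mulr1 ltr_wpDl// mulr_ge0 ?sqr_ge0 ?ltW.
- by ring.
- have -> : b = k * rho2 / rho1 by rewrite kb mulrC mulKf.
  by field.
- by field.
Qed.

(** The lower bound keeps only the kinetic energy of [psi] and [w]. The
    scaling alpha / m of the first amplitude gives the inertia and stiffness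
    of [phi] the same order as its coupling with the other two. *)
Lemma quasimodes : exists B c : R, 0 < c /\
  forall n : nat, exists Phi Psi lam,
    [/\ bresse_op rho1 rho2 b k k0 l delta Phi Psi,
        c * n%:R <= nrm Phi & nrm ((0 +i* lam) *: Phi - Psi) <= B].
Proof.
have [alpha [gamma [eta [sigma [s0 ge0 [e1 e2 e3]]]]]] := quasimode_amplitudes.
pose s := alpha + gamma + l * eta.
pose B := 2^-1 * (rho1 * ((l ^+ 2 * k0 * alpha / rho1) ^+ 2
    + (delta * sigma * alpha / rho1) ^+ 2)
  + rho2 * (k * s / rho2) ^+ 2 + rho1 * ((k0 * l * alpha + l * k * s) / rho1) ^+ 2).
pose c := 2^-1 * sigma ^+ 2 * (rho2 * gamma ^+ 2 + rho1 * eta ^+ 2).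
have c0 : 0 < c by rewrite !mulr_gt0 ?invr_gt0 ?exprn_gt0.
exists (Num.sqrt B), (Num.sqrt c); split; first by rewrite sqrtr_gt0.
move=> n; have := @freq_gt0 R n.
have : n.+1%:R <= @freq R n :> R.
  by rewrite /freq ler_peMr// (le_trans _ (@pi_ge2 R))// ler1n.
have op := bresse_op_mode n rho1 rho2 b k k0 l delta.
have nsq := bresse_normsq_mode n rho1 rho2 b k k0 l.
set m := freq n in op nsq * => mn m0.
pose lam := sigma * m.
pose a : R[i] := (alpha / m)%:C.
eexists (mode n a ((0 +i* lam) * a) gamma%:C ((0 +i* lam) * gamma%:C)
           eta%:C ((0 +i* lam) * eta%:C)), _, lam.
split; first exact: op.
  rewrite bresse_normE nsq.
  have -> : Num.sqrt c * n%:R = Num.sqrt (c * n%:R ^+ 2).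
    by rewrite (sqrtrM _ (ltW c0)) sqrtr_sqr ger0_norm.
  apply: ler_wsqrtr.
  have nsqlam g : normc ((0 +i* lam) * g%:C) ^+ 2 = (lam * g) ^+ 2.
    by rewrite sqr_normc_reim /=; ring.
  rewrite !nsqlam.
  apply: (@le_trans _ _ (c * m ^+ 2)).
    rewrite ler_wpM2l ?(ltW c0)// ler_sqr ?nnegrE ?(ltW m0)//.
    by apply: le_trans mn; rewrite ler_nat.
  have -> : c * m ^+ 2 =
      2^-1 * (rho2 * (lam * gamma) ^+ 2 + rho1 * (lam * eta) ^+ 2).
    by rewrite /c /lam; ring.
  rewrite ler_wpM2l ?invr_ge0// lerD2r lerDr.
  by rewrite !addr_ge0// mulr_ge0 ?sqr_ge0 ?ltW.
rewrite mode_lin bresse_normE nsq; apply: ler_wsqrtr.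
have m0' : m != 0 by rewrite gt_eqF.
have n1 : rho1 != 0 by rewrite gt_eqF.
have n2 : rho2 != 0 by rewrite gt_eqF.
(* Residual of the [phi] equation: the first resonance condition removes the
   term of order m; the friction contributes the imaginary part. *)
have -> : (0 +i* lam) * ((0 +i* lam) * a) -
      ((k / rho1)%:C * (- m%:C * (m%:C * a + gamma%:C + l%:C * eta%:C)) +
       (l * k0 / rho1)%:C * - (m%:C * eta%:C + l%:C * a) -
       (delta / rho1)%:C * ((0 +i* lam) * a)) =
    (l ^+ 2 * k0 * alpha / m / rho1) +i* (delta * sigma * alpha / rho1).
  apply/eqP; rewrite eq_complex /=; apply/andP; split; apply/eqP; rewrite /lam.
    transitivity (m / rho1 * (alpha * (k - rho1 * sigma ^+ 2) + k * gamma
        + l * (k + k0) * eta) + l ^+ 2 * k0 * alpha / m / rho1).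
      by field; rewrite n1.
    by rewrite e1 mulr0 add0r.
  by field; rewrite n1.
have -> : (0 +i* lam) * ((0 +i* lam) * gamma%:C) -
      ((b / rho2)%:C * (m%:C * (- m%:C * gamma%:C)) -
       (k / rho2)%:C * (m%:C * a + gamma%:C + l%:C * eta%:C)) = (k * s / rho2)%:C.
  apply/eqP; rewrite eq_complex /=; apply/andP; split; apply/eqP; rewrite /lam.
    transitivity (m ^+ 2 / rho2 * (gamma * (b - rho2 * sigma ^+ 2)) + k * s / rho2).
      by rewrite /s; field; rewrite n2.
    by rewrite e2 mulr0 add0r.
  by ring.
have -> : (0 +i* lam) * ((0 +i* lam) * eta%:C) -
      ((k0 / rho1)%:C * (m%:C * - (m%:C * eta%:C + l%:C * a)) -
       (l * k / rho1)%:C * (m%:C * a + gamma%:C + l%:C * eta%:C)) =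
    ((k0 * l * alpha + l * k * s) / rho1)%:C.
  apply/eqP; rewrite eq_complex /=; apply/andP; split; apply/eqP; rewrite /lam.
    transitivity (m ^+ 2 / rho1 * (eta * (k0 - rho1 * sigma ^+ 2))
        + (k0 * l * alpha + l * k * s) / rho1).
      by rewrite /s; field; rewrite n1.
    by rewrite e3 mulr0 add0r.
  by ring.
rewrite !subrr !mulr0 !addr0 oppr0 ComplexField.Normc.normc0 !sqr_normc_reim.
rewrite /= !expr0n /= !mulr0 !addr0 !add0r /B.
rewrite ler_wpM2l ?invr_ge0// !lerD2r ler_wpM2l ?(ltW hrho1)// lerD2r.
have -> : l ^+ 2 * k0 * alpha / m / rho1 = (l ^+ 2 * k0 * alpha / rho1) / m.
  by field; rewrite ?n1 ?m0'.
rewrite expr_div_n ler_pdivrMr ?exprn_gt0// ler_peMr ?sqr_ge0// exprn_ege1//.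
by apply: le_trans mn; rewrite ler1n.
Qed.

End Quasimodes.

Theorem theorem3p1 (R : realType) (rho1 rho2 b k k0 l delta : R)
    (hrho1 : 0 < rho1) (hrho2 : 0 < rho2) (hb : 0 < b) (hk : 0 < k)
    (hk0 : 0 < k0) (hl : 0 < l) (hdelta : 0 < delta)
    (hlpi : forall p : int, l <> p%:~R * pi)
    (T : R -> bresse_space R -> bresse_space R) :
  is_C0_semigroup (bresse_norm rho1 rho2 b k k0 l) T ->
  generates (bresse_norm rho1 rho2 b k k0 l)
    (bresse_op rho1 rho2 b k k0 l delta) T ->
  ~ exp_stable (bresse_norm rho1 rho2 b k k0 l) T.
Proof.
move=> hT hgen hexp.
have nrmP := bresse_norm_seminorm rho1 rho2 b k k0 l hrho1 hrho2 hb hk hk0.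
have [K resK] := resolvent_bound R _ _ nrmP _ _ hT hgen hexp.
have [B [c [c0 qm]]] := quasimodes rho1 rho2 b k k0 l delta hrho1 hrho2 hb hk hk0.
pose n := (Num.truncn (`|K| * B / c)).+1.
have [Phi [Psi [lam [op lo hi]]]] := qm n.
have := resK _ _ lam op; apply/negP; rewrite -ltNge.
have KBn : `|K| * B < c * n%:R by rewrite -ltr_pdivrMl// mulrC /n truncnS_gt.
apply: le_lt_trans (lt_le_trans KBn lo).
apply: le_trans (ler_wpM2l (normr_ge0 K) hi).
by apply: ler_wpM2r (ler_norm K); exact: (seminorm_ge0 _ _ _ nrmP).
Qed.
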